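(* Let $n\ge1$. For every polynomial invariant function $F(A,B)$ of two $n\times n$ complex matrices, the Gaussian two-Hermitian-matrix expectation value and the Gaussian complex-matrix expectation value of $F$ coincide: $$\langle F\rangle_H=\langle F\rangle_C ,$$ as an equality between polynomials in $\alpha_1/\delta$, $\alpha_2/\delta$, $\gamma/\delta$, i.e. for all $\alpha_1,\alpha_2,\gamma\in\mathbb{C}$ with $\delta:=\alpha_1\alpha_2-\gamma^2\ne0$.
   Context: A monomial invariant function is a function of the form $F(A,B)=\prod_{t=1}^p\operatorname{Tr}\big(\prod_{r=1}^{R_t}A^{k_{t,r}}B^{l_{t,r}}\big)$ with non-negative integers $k_{t,r},l_{t,r}$ such that $k_{t,r}+l_{t,r}>0$ (the case $p=0$ being $F=1$). A polynomial invariant function is a finite complex linear combination of monomial invariant functions. $H_n$ is the space of $n\times n$ Hermitian matrices with measure $dM=\prod_i dM_{ii}\prod_{i<j}d\,\mathrm{Re}M_{ij}\,d\,\mathrm{Im}M_{ij}$, and $\mathrm{Mat}_n(\mathbb{C})$ is the space of all $n\times n$ complex matrices with $dZ=\prod_{i,j}d\,\mathrm{Re}Z_{ij}\,d\,\mathrm{Im}Z_{ij}$. Define $$\langle F\rangle_H:=\frac{\int_{H_n\times H_n}dM_1dM_2\,F(M_1,M_2)\,e^{-\operatorname{Tr}(\frac{\alpha_1}{2}M_1^2+\frac{\alpha_2}{2}M_2^2+\gamma M_1M_2)}}{\int_{H_n\times H_n}dM_1dM_2\,e^{-\operatorname{Tr}(\frac{\alpha_1}{2}M_1^2+\frac{\alpha_2}{2}M_2^2+\gamma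 M_1M_2)}}$$ when $\mathrm{Re}(\alpha_1e^{\phi}+\alpha_2e^{-\phi}\pm2\gamma)>0$ for all $\phi\in\mathbb{R}$ (absolute convergence), and $$\langle F\rangle_C:=\frac{\int_{\mathrm{Mat}_n(\mathbb{C})}dZ\,F(Z,Z^\dagger)\,e^{-\operatorname{Tr}(\frac{\alpha_1}{2}Z^2+\frac{\alpha_2}{2}{Z^\dagger}^2+\gamma ZZ^\dagger)}}{\int_{\mathrm{Mat}_n(\mathbb{C})}dZ\,e^{-\operatorname{Tr}(\frac{\alpha_1}{2}Z^2+\frac{\alpha_2}{2}{Z^\dagger}^2+\gamma ZZ^\dagger)}}$$ when $\mathrm{Re}(\alpha_1e^{i\theta}+\alpha_2e^{-i\theta}+2\gamma)>0$ for all $\theta\in\mathbb{R}$ (absolute convergence). These two parameter domains are disjoint. On its own domain each of $\langle F\rangle_H$, $\langle F\rangle_C$ is a polynomial in $\alpha_1/\delta,\alpha_2/\delta,\gamma/\delta$, and each is extended by that polynomial expression to all $(\alpha_1,\alpha_2,\gamma)$ with $\delta\ne0$. *)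

(* Defs.v *)
From HB Require Import structures.
From mathcomp Require Import all_boot all_order all_algebra complex.
From mathcomp Require Import -(notations) mpoly.
From mathcomp Require Import all_classical all_reals all_analysis.

Set Implicit Arguments.
Unset Strict Implicit.
Unset Printing Implicit Defensive.

Import Order.TTheory GRing.Theory Num.Theory.
Import numFieldNormedType.Exports.

Local Open Scope classical_set_scope.
Local Open Scope ring_scope.
Local Open Scope complex_scope.

(* The product sigma-finite instance of product_measure1 is shadowed in the
   library by its finite-measure instances, hence the explicit sigma-finiteness
   proof below. *)
Section LebesgueTuple.
Variable R : realType.
Local Notation mR := (measurableTypeR R).

Definition tuple_of_pair k (x : mR * k.-tuple mR) : k.+1.-tuple mR :=
  [the k.+1.-tuple mR of x.1 :: x.2].

Lemma measurable_tuple_of_pair k :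
  measurable_fun [set: mR * k.-tuple mR] (@tuple_of_pair k).
Proof. exact: measurable_cons. Qed.

Definition lebesgue_cons k
    (mu : {sigma_finite_measure set (k.-tuple mR) -> \bar R}) :
    set (k.+1.-tuple mR) -> \bar R :=
  pushforward (lebesgue_measure \x mu)%E (@tuple_of_pair k).

Section lebesgue_cons_measure.
Variables (k : nat) (mu : {sigma_finite_measure set (k.-tuple mR) -> \bar R}).
Local Notation nu := (@lebesgue_cons k mu).

Let m_push : {measure set (k.+1.-tuple mR) -> \bar R} :=
  measure_function_pushforward__canonical__measure_function_Measure
    (lebesgue_measure \x mu)%E (@measurable_tuple_of_pair k).

Let nu0 : nu set0 = 0%E.
Proof. exact: (measure0 m_push). Qed.

Let nu_ge0 A : (0 <= nu A)%E.
Proof. exact: (measure_ge0 m_push). Qed.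

Let nu_sigma_additive : semi_sigma_additive nu.
Proof. exact: (@measure_semi_sigma_additive _ _ _ m_push). Qed.

HB.instance Definition _ := isMeasure.Build _ _ _ nu nu0 nu_ge0 nu_sigma_additive.

Let pair_of_tuple (t : k.+1.-tuple mR) : mR * k.-tuple mR :=
  (tnth t ord0, [tuple of behead t]).

Let measurable_pair_of_tuple : measurable_fun setT pair_of_tuple.
Proof.
by apply/measurable_fun_pair; [exact: measurable_tnth|exact: measurable_behead].
Qed.

Let tuple_of_pairK : cancel (@tuple_of_pair k) pair_of_tuple.
Proof. by case=> a t; congr pair; apply: val_inj. Qed.

Let nu_sigma_finite : sigma_finite setT nu.
Proof.
have [F FT Foo] : sigma_finite setT (lebesgue_measure \x mu)%E.
  have /sigma_finiteP[F [TF ndF Foo]] := sigma_finiteT (@lebesgue_measure R).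
  have /sigma_finiteP[G [TG ndG Goo]] := sigma_finiteT mu.
  exists (fun i => F i `*` G i).
    rewrite -setXTT TF TG predeqE => -[x y]; split.
      move=> [/= [i _ Fix] [j _ Gjy]]; exists (maxn i j) => //; split.
      - by move: x Fix; exact/subsetPset/ndF/leq_maxl.
      - by move: y Gjy; exact/subsetPset/ndG/leq_maxr.
    by move=> [i _ []/= ? ?]; split; exists i.
  move=> i; have [? ?] := Foo i; have [? ?] := Goo i.
  split; first exact: measurableX.
  by rewrite product_measure1E// lte_mul_pinfty// ge0_fin_numE.
exists (fun i => pair_of_tuple @^-1` F i).
  by rewrite -preimage_bigcup -FT.
move=> i; have [mFi Fioo] := Foo i; split.
  by rewrite -[X in measurable X]setTI; exact: measurable_pair_of_tuple.
rewrite /lebesgue_cons /pushforward -comp_preimage.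
by rewrite (_ : _ \o _ = id) //; apply/funext => x /=; rewrite tuple_of_pairK.
Qed.

HB.instance Definition _ := Measure_isSigmaFinite.Build _ _ _ nu nu_sigma_finite.
End lebesgue_cons_measure.

(* k-dimensional Lebesgue measure; lebesgue_tuple_box pins it down. *)
Fixpoint lebesgue_tuple k : {sigma_finite_measure set (k.-tuple mR) -> \bar R} :=
  match k with
  | 0 => dirac (nil_tuple mR)
  | k'.+1 => lebesgue_cons (lebesgue_tuple k')
  end.

Lemma lebesgue_tuple_box k (A : 'I_k -> set mR) :
  (forall i, measurable (A i)) ->
  lebesgue_tuple k [set t | forall i, A i (tnth t i)] =
  (\prod_(i < k) lebesgue_measure (A i))%E.
Proof.
elim: k A => [|k IHk] A mA.
  rewrite big_ord0 /= diracE mem_set//= => -[].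
  by [].
rewrite big_ord_recl /= /lebesgue_cons /pushforward.
rewrite (_ : _ @^-1` _ =
  A ord0 `*` [set t | forall i, A (lift ord0 i) (tnth t i)]); last first.
  apply/seteqP; split=> -[a t] /=.
    move=> At; split; first exact: (At ord0).
    by move=> i; have := At (lift ord0 i); rewrite tnthS.
  case=> Aa At i; have [->//|[j ->]] : i = ord0 \/ exists j, i = lift ord0 j.
    by case: (unliftP ord0 i) => [j ->|->]; [right; exists j|left].
  by rewrite tnthS; exact: At.
have mB : measurable [set t : k.-tuple mR | forall i, A (lift ord0 i) (tnth t i)].
  have -> : [set t : k.-tuple mR | forall i, A (lift ord0 i) (tnth t i)] =
      \bigcap_(i in [set: 'I_k]) ((@tnth _ mR ^~ i) @^-1` A (lift ord0 i)).
    by apply/seteqP; split=> t /= h i => [_|]; exact: h.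
  apply: fin_bigcap_measurable => [|i _]; first exact: finite_finset.
  by rewrite -[X in measurable X]setTI; exact: measurable_tnth.
rewrite product_measure1E//; congr mule; exact: (IHk (fun i => A (lift ord0 i))).
Qed.

End LebesgueTuple.

Section MatrixIntegrals.
Variable R : realType.
Local Notation C := R[i].
Local Notation Re := (@complex.Re R).
Local Notation Im := (@complex.Im R).

Definition cexp (z : C) : C :=
  (expR (Re z))%:C * (cos (Im z) +i* sin (Im z)).

Definition cintegrable d (T : measurableType d)
    (mu : {measure set T -> \bar R}) (f : T -> C) : Prop :=
  mu.-integrable setT (fun x => (Re (f x))%:E) /\
  mu.-integrable setT (fun x => (Im (f x))%:E).

Definition cintegral d (T : measurableType d)
    (mu : {measure set T -> \bar R}) (f : T -> C) : C :=
  (\int[mu]_x Re (f x)) +i* (\int[mu]_x Im (f x)).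

Variable n : nat.

(* F(A,B) = \prod_t \tr (\prod_r A^k_{t,r} B^l_{t,r}), where w is the list over t
   of the lists over r of the pairs (k_{t,r}, l_{t,r}). *)
Definition invariant_monomial (w : seq (seq (nat * nat))) (A B : 'M[C]_n) : C :=
  \prod_(t <- w) \tr (\prod_(kl <- t) (A ^+ kl.1 * B ^+ kl.2)).

Definition monomial_invariant (F : 'M[C]_n -> 'M[C]_n -> C) : Prop :=
  exists2 w : seq (seq (nat * nat)),
    all (all (fun kl => 0 < kl.1 + kl.2)%N) w & F =2 invariant_monomial w.

Definition polynomial_invariant (F : 'M[C]_n -> 'M[C]_n -> C) : Prop :=
  exists (N : nat) (c : 'I_N -> C) (G : 'I_N -> 'M[C]_n -> 'M[C]_n -> C),
    (forall i, monomial_invariant (G i)) /\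
    (forall A B, F A B = \sum_(i < N) c i * G i A B).

Local Notation coords := ((n * n).-tuple (measurableTypeR R)).

Definition real_mx (x : coords) : 'M[R]_n :=
  \matrix_(i, j) tnth x (mxvec_index i j).

(* Re M_ij (i < j) is stored at (i, j), Im M_ij at (j, i) and M_ii at (i, i), so
   that Lebesgue measure on the entries of X is the measure dM on H_n. *)
Definition hermitian_of (X : 'M[R]_n) : 'M[C]_n :=
  \matrix_(i, j) if i == j then (X i i)%:C
                 else if (i < j)%N then X i j +i* X j i
                 else X j i -i* X i j.

Definition complex_of (X Y : 'M[R]_n) : 'M[C]_n :=
  \matrix_(i, j) (X i j +i* Y i j).

Definition dagger (Z : 'M[C]_n) : 'M[C]_n := (map_mx (@conjc R) Z)^T.

(* dM_1 dM_2 under herm_pair, and dZ under complex_pair. *)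
Definition lebesgue_coords2 : {measure set (coords * coords) -> \bar R} :=
  (lebesgue_tuple R (n * n) \x lebesgue_tuple R (n * n))%E.

Definition herm_pair (x : coords * coords) : 'M[C]_n * 'M[C]_n :=
  (hermitian_of (real_mx x.1), hermitian_of (real_mx x.2)).

Definition complex_pair (x : coords * coords) : 'M[C]_n * 'M[C]_n :=
  let Z := complex_of (real_mx x.1) (real_mx x.2) in (Z, dagger Z).

(* For n x n matrices, the ring product and power are the matrix ones. *)
Definition gauss_weight (a1 a2 g : C) (A B : 'M[C]_n) : C :=
  cexp (- \tr ((a1 / 2) *: A ^+ 2 + (a2 / 2) *: B ^+ 2 + g *: (A * B))).

Section Expectation.
Variable e : coords * coords -> 'M[C]_n * 'M[C]_n.

Definition weight_at (a1 a2 g : C) (x : coords * coords) : C :=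
  gauss_weight a1 a2 g (e x).1 (e x).2.

Definition weighted_at (F : 'M[C]_n -> 'M[C]_n -> C) (a1 a2 g : C)
    (x : coords * coords) : C :=
  F (e x).1 (e x).2 * weight_at a1 a2 g x.

Definition gauss_expectation (F : 'M[C]_n -> 'M[C]_n -> C) (a1 a2 g : C) : C :=
  cintegral lebesgue_coords2 (weighted_at F a1 a2 g) /
  cintegral lebesgue_coords2 (weight_at a1 a2 g).

Definition expectation_defined (F : 'M[C]_n -> 'M[C]_n -> C) (a1 a2 g : C) : Prop :=
  [/\ cintegrable lebesgue_coords2 (weighted_at F a1 a2 g),
      cintegrable lebesgue_coords2 (weight_at a1 a2 g)
    & cintegral lebesgue_coords2 (weight_at a1 a2 g) != 0].
End Expectation.

(* The pointwise condition alone admits the degenerate parameters with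
   Re g = 0 and exactly one of Re a1, Re a2 equal to 0 (the other positive), where
   the integral is not absolutely convergent; absolute convergence is therefore
   part of the domain.  On domain_C it is automatic. *)
Definition domain_H (a1 a2 g : C) : Prop :=
  (forall phi : R,
     0 < Re (a1 * (expR phi)%:C + a2 * (expR (- phi))%:C + 2 * g) /\
     0 < Re (a1 * (expR phi)%:C + a2 * (expR (- phi))%:C - 2 * g)) /\
  cintegrable lebesgue_coords2 (weight_at herm_pair a1 a2 g).

Definition domain_C (a1 a2 g : C) : Prop :=
  forall theta : R,
    0 < Re (a1 * cexp (0 +i* theta) + a2 * cexp (0 -i* theta) + 2 * g).

Definition delta (a1 a2 g : C) : C := a1 * a2 - g ^+ 2.

Definition eval_ratios (P : mpoly.mpoly 3 C) (a1 a2 g : C) : C :=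
  mpoly.meval (tnth [tuple a1 / delta a1 a2 g; a2 / delta a1 a2 g;
                           g / delta a1 a2 g]) P.

Definition polynomial_on (dom : C -> C -> C -> Prop) (E : C -> C -> C -> C)
    (P : mpoly.mpoly 3 C) : Prop :=
  forall a1 a2 g, dom a1 a2 g -> E a1 a2 g = eval_ratios P a1 a2 g.

(* The polynomial chosen is unique, because the values of (a1, a2, g) / delta on
   domain_H and on domain_C contain nonempty open sets; its existence is part of
   the statement of the theorem. *)
Definition extension (dom : C -> C -> C -> Prop) (E : C -> C -> C -> C) :
    C -> C -> C -> C :=
  eval_ratios (xget 0 [set P | polynomial_on dom E P]).

Definition expectation_H (F : 'M[C]_n -> 'M[C]_n -> C) : C -> C -> C -> C :=
  extension domain_H (gauss_expectation herm_pair F).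

Definition expectation_C (F : 'M[C]_n -> 'M[C]_n -> C) : C -> C -> C -> C :=
  extension domain_C (gauss_expectation complex_pair F).

End MatrixIntegrals.

(* Main.v *)
(** Writing the entries of [A] and [B] as complex linear forms on the real
parameter space, both Gaussian weights are [exp (- S (A, B))] for the same
quadratic polynomial [S].  In both cases the complexified parameter space is all
of pairs of matrices, so integration by parts in the real directions yields, by
complex linearity, integration by parts in an arbitrary complex direction of
[(A, B)].  Choosing the directions that are dual to the entries with respect to [S]
gives the Wick recursion with the same covariances ([a2 / delta] for [A A],
[a1 / delta] for [B B], [- g / delta] for [A B]) for both ensembles, hence the same
polynomial in the ratios.  That the partition functions do not vanish follows by
deforming the imaginary part of [S] to [0]: if the partition function vanishes,
then so do all moments, hence, expanding the exponential, all nearby partition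
functions. *)
Require Import Defs.
From mathcomp Require Import all_boot all_order all_algebra complex.
From mathcomp Require Import -(notations) mpoly.
From mathcomp Require Import all_classical all_reals all_analysis.
From mathcomp Require Import measurable_realfun ring lra.
Set Implicit Arguments.
Unset Strict Implicit.
Unset Printing Implicit Defensive.
Import Order.TTheory GRing.Theory Num.Theory.
Import numFieldNormedType.Exports.
Local Open Scope classical_set_scope.
Local Open Scope ring_scope.
Local Open Scope complex_scope.

(** * Integration by parts in one real direction *)

(** For complex parameters the quadratic form is not real in general, so it cannot simply be
    diagonalised by an orthogonal change of variables. Neither partition function is therefore
    computed: the recursion expresses every moment as a multiple of it, and only its nonvanishing is
    proved. The common argument is carried out for an abstract map [e] from real coordinates to
    pairs of matrices, subject to linearity, [e_span], [coercive] and [real_imaginary_split]. That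
    [delta] does not vanish on the two domains is not assumed; it follows from coercivity. Specific
    to an ensemble is mainly the proof that its parameter domain implies [coercive]; on the
    Hermitian side the degenerate parameters allowed by the pointwise inequality are excluded by
    absolute convergence. Finally, [extension] selects some polynomial that agrees with the
    expectation on the domain, so this agreement must be shown to determine the polynomial; for that
    it suffices that the ratios reached by real parameters of the domain contain a box. *)

Section DirectionalIbp.
Variable R : realType.

(* [f] has derivative [g] along each curve [s |-> upd s t]; the derivative [h] of
   [g] serves only to make [g] continuous along these curves. *)
Definition integrates_derivatives_to0 d (T : measurableType d)
    (mu : set T -> \bar R) (upd : R -> T -> T) : Prop :=
  forall f g h : T -> R, mu.-integrable setT (EFin \o g) ->
  (forall t s, is_derive s (1 : R) (fun s => f (upd s t)) (g (upd s t))) ->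
  (forall t s, is_derive s (1 : R) (fun s => g (upd s t)) (h (upd s t))) ->
  (forall t, f (upd m%:R t) @[m --> \oo] --> (0 : R)) ->
  (forall t, f (upd (- m%:R) t) @[m --> \oo] --> (0 : R)) ->
  (\int[mu]_x (g x)%:E = 0)%E.

Lemma lebesgue_integral_derivative0 (f g h : R -> R) :
  (@lebesgue_measure R).-integrable setT (EFin \o g) ->
  (forall s, is_derive s (1 : R) f (g s)) ->
  (forall s, is_derive s (1 : R) g (h s)) ->
  f m%:R @[m --> \oo] --> (0 : R) -> f (- m%:R) @[m --> \oo] --> (0 : R) ->
  (\int[lebesgue_measure]_x (g x)%:E = 0)%E.
Proof.
move=> ig df dg fp fm.
(* The radius is [m + 1] because the fundamental theorem of calculus is applied on a nondegenerate
   interval. *)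
pose D (m : nat) : set R := [set` `[- m.+1%:R, m.+1%:R]].
have mg : measurable_fun setT (EFin \o g) by exact: measurable_int ig.
have mgr : measurable_fun setT g by exact/measurable_EFinP.
have mD m : measurable (D m) by exact: measurable_itv.
have cf : continuous (f : R -> R).
  by move=> x; apply/differentiable_continuous/derivable1_diffP; have [] := df x.
have cg : continuous (g : R -> R).
  by move=> x; apply/differentiable_continuous/derivable1_diffP; have [] := dg x.
have ftc m : (\int[lebesgue_measure]_x ((g \_ (D m)) x)%:E =
    (f m.+1%:R - f (- m.+1%:R))%:E)%E.
  transitivity (\int[lebesgue_measure]_(x in D m) (g x)%:E)%E.
    by rewrite [RHS]integral_mkcond restrict_EFin.
  rewrite EFinB; apply: (@continuous_FTC2 _ (g : R -> R)).
  - by rewrite -subr_gt0 opprK addr_gt0.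
  - exact: continuous_subspaceT.
  - split; [by move=> x _; have [] := df x|exact/cvg_at_right_filter/cf|].
    exact/cvg_at_left_filter/cf.
  - by move=> x _; rewrite derive1E; have [] := df x.
have mfD m : measurable_fun setT (EFin \o (g \_ (D m))).
  apply/measurable_EFinP; apply/(measurable_restrictT _ (mD m)).
  exact: (measurable_funS measurableT (@subsetT _ _) mgr).
have [||_ _] := @dominated_convergence _ _ _ lebesgue_measure setT measurableT
  (fun m => EFin \o (g \_ (D m))) (EFin \o g) (abse \o (EFin \o g)) mfD mg _ (integrable_abse ig) _.
- apply: aeW => x _; apply: cvg_near_cst.
  exists (Num.truncn `|x|) => // m /= xm; rewrite /= patchE mem_set//= /D /= in_itv /= -ler_norml.
  by rewrite (le_trans (ltW (truncnS_gt _)))// ler_nat.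
- apply: aeW => x m _; rewrite /= patchE; case: ifPn => // _.
  by rewrite /= normr0 lee_fin.
under eq_fun do rewrite ftc.
move=> /cvg_lim <-//; apply/cvg_lim => //.
apply: cvg_EFin; first exact: nearW.
rewrite -[X in _ --> X](subr0 (0 : R)); apply: cvgB.
  by have := fp; rewrite -(cvg_shiftS _).
by have := fm; rewrite -(cvg_shiftS _).
Qed.

Lemma lebesgue_integrates_derivatives_to0 :
  @integrates_derivatives_to0 _ (measurableTypeR R) lebesgue_measure (fun s _ => s).
Proof.
move=> f g h ig df dg fp fm.
exact: (lebesgue_integral_derivative0 ig (df 0) (dg 0) (fp 0) (fm 0)).
Qed.

(** Needed because [lebesgue_tuple] in dimension [k + 1] is a pushforward of a product. Only the
    underlying set functions of [nu] and the pushforward are equated, since [lebesgue_tuple] carries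
    its own bundled measure structure. *)
Lemma integrates_derivatives_to0_pushforward d1 d2 (T1 : measurableType d1)
    (T2 : measurableType d2) (mu : {measure set T1 -> \bar R}) (phi : T1 -> T2)
    (upd1 : R -> T1 -> T1) (upd2 : R -> T2 -> T2) :
  measurable_fun setT phi -> (forall s t, upd2 s (phi t) = phi (upd1 s t)) ->
  integrates_derivatives_to0 mu upd1 ->
  forall (nu : {measure set T2 -> \bar R}), nu = pushforward mu phi :> (set T2 -> \bar R) ->
  integrates_derivatives_to0 nu upd2.
Proof.
move=> mphi updE ibp nu nuE f g h ig df dg fp fm.
have mg : measurable_fun setT (EFin \o g) by exact: measurable_int ig.
have ig1 : mu.-integrable setT (EFin \o (g \o phi)).
  apply/integrableP; split; first exact: (measurableT_comp mg mphi).
  have /integrableP[_] := ig; rewrite nuE ge0_integral_pushforward//=.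
  by apply/measurable_EFinP; apply: measurableT_comp => //; exact/measurable_EFinP.
have -> : (\int[nu]_x (g x)%:E = \int[pushforward mu phi]_x (g x)%:E)%E by rewrite nuE.
rewrite (integral_pushforward mphi)//.
apply: (ibp (f \o phi) (g \o phi) (h \o phi)) => // t => [s|s||].
- by have := df (phi t) s; under eq_fun do rewrite updE; rewrite updE.
- by have := dg (phi t) s; under eq_fun do rewrite updE; rewrite updE.
- by have := fp (phi t); under eq_fun do rewrite updE.
- by have := fm (phi t); under eq_fun do rewrite updE.
Qed.

(** Fubini, integrating first over the variable that [upd] moves: almost every slice of [g] is
    integrable, and the pointwise hypotheses hold on every slice, so the inner integral is almost
    everywhere 0. *)
Lemma integrates_derivatives_to0_prodl d1 d2 (T1 : measurableType d1)
    (T2 : measurableType d2) (mu : {sigma_finite_measure set T1 -> \bar R})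
    (nu : {sigma_finite_measure set T2 -> \bar R}) (upd : R -> T1 -> T1) :
  integrates_derivatives_to0 mu upd ->
  integrates_derivatives_to0 (mu \x nu)%E (fun s t => (upd s t.1, t.2)).
Proof.
move=> ibp f g h ig df dg fp fm.
rewrite -(integral21_prod_meas1 ig).
transitivity (\int[nu]_x (cst 0 x : \bar R))%E; last by rewrite integral0.
apply: ae_eq_integral => //.
- exact: (measurable_fubini_G ig).
- have := ae_integrable2 ig; apply: filterS => y igy _; rewrite /fubini_G /=.
  apply: (ibp (fun x => f (x, y)) (fun x => g (x, y)) (fun x => h (x, y))) => //.
  + by move=> t s; exact: (df (t, y)).
  + by move=> t s; exact: (dg (t, y)).
  + by move=> t; exact: (fp (t, y)).
  + by move=> t; exact: (fm (t, y)).
Qed.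

Lemma integrates_derivatives_to0_prodr d1 d2 (T1 : measurableType d1)
    (T2 : measurableType d2) (mu : {sigma_finite_measure set T1 -> \bar R})
    (nu : {sigma_finite_measure set T2 -> \bar R}) (upd : R -> T2 -> T2) :
  integrates_derivatives_to0 nu upd ->
  integrates_derivatives_to0 (mu \x nu)%E (fun s t => (t.1, upd s t.2)).
Proof.
move=> ibp f g h ig df dg fp fm.
rewrite -(integral12_prod_meas1 ig).
transitivity (\int[mu]_x (cst 0 x : \bar R))%E; last by rewrite integral0.
apply: ae_eq_integral => //.
- exact: (measurable_fubini_F ig).
- have := ae_integrable1 ig; apply: filterS => x igx _; rewrite /fubini_F /=.
  apply: (ibp (fun y => f (x, y)) (fun y => g (x, y)) (fun y => h (x, y))) => //.
  + by move=> t s; exact: (df (x, t)).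
  + by move=> t s; exact: (dg (x, t)).
  + by move=> t; exact: (fp (x, t)).
  + by move=> t; exact: (fm (x, t)).
Qed.

End DirectionalIbp.

(** * Coordinate directions and Gaussian integrability for Lebesgue measure on tuples *)

Section LebesgueTupleIbp.
Variable R : realType.
Local Notation mR := (measurableTypeR R).

Definition tuple_upd k (i : 'I_k) (s : R) (t : k.-tuple mR) : k.-tuple mR :=
  [tuple if j == i then s else tnth t j | j < k].

Lemma tuple_upd_cons0 k (s a : R) (t : k.-tuple mR) :
  tuple_upd ord0 s (tuple_of_pair (a, t)) = tuple_of_pair (s, t).
Proof.
apply: eq_from_tnth => j; rewrite tnth_mktuple.
case: (unliftP ord0 j) => [j' ->|->]; last by rewrite eqxx.
by rewrite !tnthS.
Qed.

Lemma tuple_upd_consS k (i : 'I_k) (s a : R) (t : k.-tuple mR) :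
  tuple_upd (lift ord0 i) s (tuple_of_pair (a, t)) =
  tuple_of_pair (a, tuple_upd i s t).
Proof.
apply: eq_from_tnth => j; rewrite tnth_mktuple.
case: (unliftP ord0 j) => [j' ->|-> //].
by rewrite !tnthS (inj_eq lift_inj) tnth_mktuple.
Qed.

Lemma lebesgue_tuple_integrates_derivatives_to0 k (i : 'I_k) :
  integrates_derivatives_to0 (lebesgue_tuple R k) (tuple_upd i).
Proof.
elim: k i => [[//]|k IHk] i; case: (unliftP ord0 i) => [j|] ->.
- apply: (integrates_derivatives_to0_pushforward
    (@measurable_tuple_of_pair R k) _
    (@integrates_derivatives_to0_prodr R _ _ _ _ lebesgue_measure _ _ (IHk j))) => //.
  by move=> s [a t]; rewrite tuple_upd_consS.
- apply: (integrates_derivatives_to0_pushforward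
    (@measurable_tuple_of_pair R k) _
    (@integrates_derivatives_to0_prodl R _ _ _ _ _ (lebesgue_tuple R k) _
       (lebesgue_integrates_derivatives_to0 (R:=R)))) => //.
  by move=> s [a t]; rewrite tuple_upd_cons0.
Qed.

Lemma integrable_prodM d1 d2 (T1 : measurableType d1) (T2 : measurableType d2)
    (mu : {sigma_finite_measure set T1 -> \bar R})
    (nu : {sigma_finite_measure set T2 -> \bar R}) (f : T1 -> R) (g : T2 -> R) :
  mu.-integrable setT (EFin \o f) -> nu.-integrable setT (EFin \o g) ->
  (mu \x nu)%E.-integrable setT (fun p => (f p.1 * g p.2)%:E).
Proof.
move=> fi gi.
have mf : measurable_fun setT f by apply/measurable_EFinP; exact: measurable_int fi.
have mg : measurable_fun setT g by apply/measurable_EFinP; exact: measurable_int gi.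
have mfg : measurable_fun setT (fun p : T1 * T2 => (f p.1 * g p.2)%:E).
  by apply/measurable_EFinP; apply: measurable_funM; exact: measurableT_comp.
apply/(integrable12ltyP _ _ mfg).
have -> : (\int[mu]_x \int[nu]_y `|(f x * g y)%:E| =
    \int[mu]_x (`|(f x)%:E| * \int[nu]_y `|(g y)%:E|))%E.
  apply: eq_integral => x _; rewrite -ge0_integralZl//; last first.
    by apply/measurable_EFinP; exact: measurableT_comp.
  by apply: eq_integral => y _; rewrite EFinM abseM.
have /integrableP[_ fi'] := fi; have /integrableP[_ gi'] := gi.
rewrite ge0_integralZr//; last 2 first.
- by apply/measurable_EFinP; exact: measurableT_comp.
- exact: integral_ge0.
by rewrite lte_mul_pinfty//; [exact: integral_ge0|rewrite ge0_fin_numE//; exact: integral_ge0].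
Qed.

Lemma integrable_gauss (e : R) : 0 < e ->
  (@lebesgue_measure R).-integrable setT (fun x => (expR (- (e * x ^+ 2)))%:E).
Proof.
(* With variance [1 / (2 * e)] the centred normal density is a constant multiple of the given
   Gaussian. *)
move=> e0; set s := Num.sqrt (2 * e)^-1.
have s0 : s != 0 by rewrite sqrtr_eq0 -ltNge invr_gt0 mulr_gt0.
have ig := integrableZl measurableT (normal_peak s)^-1 (integrable_normal_pdf 0 s).
apply: eq_integrable ig => // x _.
rewrite -EFinM normal_pdfE// mulKf; last by rewrite gt_eqF// normal_peak_gt0.
rewrite /normal_fun subr0 sqr_sqrtr ?invr_ge0 ?mulr_ge0 ?ltW//.
congr (expR _)%:E; have e00 : e != 0 by rewrite gt_eqF.
by rewrite -mulr_natr; field.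
Qed.

Definition sqnorm k (t : k.-tuple mR) : R := \sum_(i < k) tnth t i ^+ 2.

Lemma sqnorm_cons k (a : R) (t : k.-tuple mR) :
  sqnorm (tuple_of_pair (a, t)) = a ^+ 2 + sqnorm t.
Proof.
by rewrite /sqnorm big_ord_recl; congr (_ + _); apply: eq_bigr => i _; rewrite tnthS.
Qed.

Lemma measurable_sqnorm k : measurable_fun setT (@sqnorm k).
Proof.
apply: measurable_sum => i; apply: measurable_funX; exact: measurable_tnth.
Qed.

Lemma measurable_gauss_tuple k (e : R) :
  measurable_fun setT (fun t : k.-tuple mR => expR (- (e * sqnorm t))).
Proof.
apply: measurableT_comp => //; apply: measurable_funN; apply: measurable_funM => //.
exact: measurable_sqnorm.
Qed.

Lemma integrable_gauss_tuple k (e : R) : 0 < e ->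
  (lebesgue_tuple R k).-integrable setT (fun t => (expR (- (e * sqnorm t)))%:E).
Proof.
move=> e0; elim: k => [|k IHk].
  have mg := @measurable_gauss_tuple 0 e.
  apply/integrableP; split; first exact/measurable_EFinP.
  rewrite integral_dirac//=; last by apply/measurable_EFinP; exact: measurableT_comp.
  by rewrite diracT mul1e ltry.
apply: integrable_pushforward => //.
- exact: measurable_tuple_of_pair.
- by apply/measurable_EFinP; exact: measurable_gauss_tuple.
- have := integrable_prodM (integrable_gauss e0) IHk.
  apply: eq_integrable => // -[a t] _ /=.
  by rewrite sqnorm_cons -expRD mulrDr opprD.
Qed.
End LebesgueTupleIbp.

(** * Gaussian decay and complex-valued integrals *)

Section GaussianDecay.
Variables (R : realType) (m : nat).
Local Notation mR := (measurableTypeR R).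
Local Notation C := R[i].
Local Notation Re := (@complex.Re R).
Local Notation Im := (@complex.Im R).
Local Notation tup := (m.-tuple (measurableTypeR R)).
Local Notation T := (tup * tup)%type.
Local Notation mu := (lebesgue_tuple R m \x lebesgue_tuple R m)%E.

Definition coord (j : 'I_m + 'I_m) (x : T) : R :=
  match j with inl i => tnth x.1 i | inr i => tnth x.2 i end.

Definition upd (j : 'I_m + 'I_m) (s : R) (x : T) : T :=
  match j with
  | inl i => (tuple_upd i s x.1, x.2)
  | inr i => (x.1, tuple_upd i s x.2)
  end.

Definition sqnorm2 (x : T) : R := sqnorm x.1 + sqnorm x.2.

Lemma coord_upd j k s x : coord k (upd j s x) = if k == j then s else coord k x.
Proof.
by case: j k => j [k|k] //=; rewrite tnth_mktuple ?(inj_eq inl_inj) ?(inj_eq inr_inj).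
Qed.

Lemma sqnorm2E x : sqnorm2 x = \sum_j coord j x ^+ 2.
Proof. by rewrite big_sumType. Qed.

Lemma sqnorm2_ge0 x : 0 <= sqnorm2 x.
Proof. by rewrite sqnorm2E sumr_ge0// => j _; rewrite sqr_ge0. Qed.

Lemma sqr_coord_le j x : coord j x ^+ 2 <= sqnorm2 x.
Proof.
by rewrite sqnorm2E (bigD1 j)//= lerDl sumr_ge0// => k _; rewrite sqr_ge0.
Qed.

Lemma measurable_coord j : measurable_fun setT (coord j).
Proof. 
case: j => i.
- exact: (measurableT_comp (measurable_tnth i) measurable_fst).
- exact: (measurableT_comp (measurable_tnth i) measurable_snd).
Qed.

Lemma upd_integrates_derivatives_to0 j : integrates_derivatives_to0 mu (upd j).
Proof.
by case: j => i; [apply: integrates_derivatives_to0_prodl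
                 |apply: integrates_derivatives_to0_prodr];
  exact: lebesgue_tuple_integrates_derivatives_to0.
Qed.

Lemma integrable_gauss2 (e : R) : 0 < e ->
  mu.-integrable setT (fun x => (expR (- (e * sqnorm2 x)))%:E).
Proof.
move=> e0.
have := integrable_prodM (integrable_gauss_tuple m e0) (integrable_gauss_tuple m e0).
by apply: eq_integrable => // x _; rewrite -expRD -opprD -mulrDr.
Qed.

(** Stands in for polynomial growth: the class is closed under sums and products, contains the
    coordinates, and multiplication by a member preserves Gaussian decay at the cost of half the
    rate. *)
Definition subgauss (f : T -> R) : Prop := measurable_fun setT f /\
  forall e, 0 < e -> exists K, forall x, `|f x| <= K * expR (e * sqnorm2 x).

Definition decays (f : T -> R) : Prop := measurable_fun setT f /\
  exists K e, 0 < e /\ forall x, `|f x| <= K * expR (- (e * sqnorm2 x)).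

Lemma subgauss_cst a : subgauss (cst a).
Proof.
split=> // e e0; exists `|a| => x; rewrite ler_peMr// -expR0 ler_expR.
by rewrite mulr_ge0 ?sqnorm2_ge0// ltW.
Qed.

Lemma subgaussD f g : subgauss f -> subgauss g -> subgauss (fun x => f x + g x).
Proof.
move=> [mf Hf] [mg Hg]; split=> [|e e0]; first exact: measurable_funD.
have [K HK] := Hf _ e0; have [L HL] := Hg _ e0.
by exists (K + L) => x; rewrite (le_trans (ler_normD _ _))// mulrDl lerD.
Qed.

Lemma subgaussM f g : subgauss f -> subgauss g -> subgauss (fun x => f x * g x).
Proof.
move=> [mf Hf] [mg Hg]; split=> [|e e0]; first exact: measurable_funM.
have e20 : 0 < e / 2 by rewrite divr_gt0.
have [K HK] := Hf _ e20; have [L HL] := Hg _ e20.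
exists (K * L) => x; rewrite normrM [e]splitr mulrDl expRD mulrACA.
by rewrite ler_pM.
Qed.

Lemma subgaussN f : subgauss f -> subgauss (fun x => - f x).
Proof.
move=> sf; have := subgaussM (subgauss_cst (-1)) sf.
by rewrite (_ : (fun x => cst (-1) x * f x) = (fun x => - f x))//;
  apply/funext => x; rewrite mulN1r.
Qed.

Lemma subgauss_of_sqr_le (f : T -> R) : measurable_fun setT f ->
  (forall x, f x ^+ 2 <= sqnorm2 x) -> subgauss f.
Proof.
(* From [|f| <= 1 + f ^ 2 <= 1 + r] with [r] the squared norm: the exponential bounds [1], and
   [e^-1] times the exponential bounds [r]. *)
move=> mf Hf; split=> // e e0; exists (1 + e^-1) => x.
have f1 : `|f x| <= 1 + sqnorm2 x.
  apply: le_trans (_ : 1 + f x ^+ 2 <= _); last by rewrite lerD2l.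
  by rewrite -real_normK ?num_real//; nra.
apply: le_trans f1 _.
have r0 := sqnorm2_ge0 x; have h1 := expR_ge1Dx (e * sqnorm2 x).
have er0 : 0 <= e * sqnorm2 x by rewrite mulr_ge0 ?sqnorm2_ge0// ltW.
rewrite mulrDl lerD//; first by rewrite mul1r (le_trans _ h1)// lerDl.
by rewrite ler_pdivlMl// (le_trans _ h1)// lerDr.
Qed.

Lemma subgauss_decays f g : subgauss f -> decays g -> decays (fun x => f x * g x).
Proof.
move=> [mf Hf] [mg [L [e [e0 HL]]]]; split; first exact: measurable_funM.
have e20 : 0 < e / 2 by rewrite divr_gt0.
have [K HK] := Hf _ e20.
exists (K * L), (e / 2); split=> // x.
rewrite normrM (le_trans (ler_pM _ _ (HK x) (HL x)))//.
by rewrite mulrACA -expRD [X in - (X * _)]splitr mulrDl opprD addNKr.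
Qed.

Lemma decaysD f g : decays f -> decays g -> decays (fun x => f x + g x).
Proof.
move=> [mf [K [e [e0 HK]]]] [mg [L [e' [e'0 HL]]]]; split; first exact: measurable_funD.
exists (`|K| + `|L|), (Num.min e e'); split; first by rewrite lt_min e0.
move=> x; rewrite (le_trans (ler_normD _ _))// mulrDl.
by apply: lerD; [apply: (le_trans (HK x))|apply: (le_trans (HL x))];
  rewrite (le_trans (ler_wpM2r (expR_ge0 _) (ler_norm _)))// ler_wpM2l// ler_expR;
  rewrite lerN2 ler_wpM2r ?sqnorm2_ge0// ge_min lexx ?orbT.
Qed.

Lemma decays_integrable f : decays f -> mu.-integrable setT (EFin \o f).
Proof.
move=> [mf [K [e [e0 HK]]]].
have := integrableZl measurableT `|K| (integrable_gauss2 e0).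
apply: le_integrable => //; first exact/measurable_EFinP.
move=> x _; rewrite /= lee_fin normrM normr_id (ger0_norm (expR_ge0 _)).
by rewrite (le_trans (HK x))// ler_wpM2r ?expR_ge0// ler_norm.
Qed.

(** The condition on [u] admits both [u k = k] and [u k = - k], the two boundary limits in the
    integration by parts. *)
Lemma decays_cvg0 j f (u : nat -> R) x : decays f ->
  (forall k, k%:R <= u k ^+ 2) -> f (upd j (u k) x) @[k --> \oo] --> 0.
Proof.
move=> [mf [K [e [e0 HK]]]] Hu; apply/norm_cvg0P.
(* Then [c * (k + 1) <= 1 + e * k], so the Gaussian bound is at most [|K| / c] times the harmonic
   sequence. *)
pose c := Num.min 1 e; have c0 : 0 < c by rewrite lt_min ltr01.
apply: (@squeeze_cvgr _ _ _ _ (cst 0) (fun k => (`|K| / c) * harmonic k)).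
- apply: nearW => k; rewrite normr_ge0/=.
  apply: (le_trans (HK _)); apply: (le_trans (ler_wpM2r (expR_ge0 _) (ler_norm _))).
  rewrite -mulrA ler_wpM2l// expRN -invfM lef_pV2 ?posrE ?mulr_gt0 ?expR_gt0//.
  apply: le_trans (expR_ge1Dx _).
  have : k%:R <= sqnorm2 (upd j (u k) x).
    by apply: (le_trans (Hu k)); have := sqr_coord_le j (upd j (u k) x);
      rewrite coord_upd eqxx.
  have : c <= 1 by rewrite /c ge_min lexx.
  have : c <= e by rewrite /c ge_min lexx orbT.
  have : 0 <= k%:R :> R by [].
  rewrite -natr1; nra.
- exact: cvg_cst.
- by rewrite -[X in _ --> X](mulr0 (`|K| / c)); apply: cvgMl_tmp; exact: cvg_harmonic.
Qed.

Definition csubgauss (f : T -> C) := subgauss (Re \o f) /\ subgauss (Im \o f).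
Definition cdecays (f : T -> C) := decays (Re \o f) /\ decays (Im \o f).

Lemma ReD (z w : C) : Re (z + w) = Re z + Re w.
Proof. by case: z w => [a b] [c d]. Qed.

Lemma ImD (z w : C) : Im (z + w) = Im z + Im w.
Proof. by case: z w => [a b] [c d]. Qed.

Lemma ReM (z w : C) : Re (z * w) = Re z * Re w - Im z * Im w.
Proof. by case: z w => [a b] [c d]. Qed.

Lemma ImM (z w : C) : Im (z * w) = Re z * Im w + Im z * Re w.
Proof. by case: z w => [a b] [c d]; rewrite /= [b * c]mulrC. Qed.

Lemma Re_cexp (z : C) : Re (cexp z) = expR (Re z) * cos (Im z).
Proof. by rewrite /cexp ReM/= mul0r subr0. Qed.

Lemma Im_cexp (z : C) : Im (cexp z) = expR (Re z) * sin (Im z).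
Proof. by rewrite /cexp ImM/= mul0r addr0. Qed.

Lemma csubgauss_cst a : csubgauss (fun=> a).
Proof. by split; exact: subgauss_cst. Qed.

Lemma csubgaussD f g : csubgauss f -> csubgauss g -> csubgauss (fun x => f x + g x).
Proof.
move=> [f1 f2] [g1 g2]; split.
  by have := subgaussD f1 g1; congr subgauss; apply/funext => x /=; rewrite raddfD.
by have := subgaussD f2 g2; congr subgauss; apply/funext => x /=; rewrite raddfD.
Qed.

Lemma csubgaussM f g : csubgauss f -> csubgauss g -> csubgauss (fun x => f x * g x).
Proof.
move=> [f1 f2] [g1 g2]; split.
  have := subgaussD (subgaussM f1 g1) (subgaussN (subgaussM f2 g2)).
  by congr subgauss; apply/funext => x /=; rewrite ReM.
have := subgaussD (subgaussM f1 g2) (subgaussM f2 g1).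
by congr subgauss; apply/funext => x /=; rewrite ImM.
Qed.

Lemma csubgauss_cdecays f g : csubgauss f -> cdecays g -> cdecays (fun x => f x * g x).
Proof.
move=> [f1 f2] [g1 g2]; split.
  have := decaysD (subgauss_decays f1 g1) (subgauss_decays (subgaussN f2) g2).
  by congr decays; apply/funext => x /=; rewrite ReM mulNr.
have := decaysD (subgauss_decays f1 g2) (subgauss_decays f2 g1).
by congr decays; apply/funext => x /=; rewrite ImM.
Qed.

Lemma cdecays_cintegrable f : cdecays f -> cintegrable mu f.
Proof. by move=> [f1 f2]; split; exact: decays_integrable. Qed.

End GaussianDecay.

(** * Linearity of the complex-valued integral *)

Section ComplexIntegral.
Variables (R : realType) (d : measure_display) (T : measurableType d).
Variable mu : {measure set T -> \bar R}.
Local Notation Re := (@complex.Re R).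
Local Notation Im := (@complex.Im R).
Implicit Types f g : T -> R[i].

Lemma cintegralD f g : cintegrable mu f -> cintegrable mu g ->
  cintegral mu (fun x => f x + g x) = cintegral mu f + cintegral mu g.
Proof.
move=> [f1 f2] [g1 g2]; rewrite /cintegral.
under eq_Rintegral do rewrite raddfD.
under [X in _ +i* X]eq_Rintegral do rewrite raddfD.
by rewrite !RintegralD.
Qed.

Lemma cintegralZ a f : cintegrable mu f ->
  cintegral mu (fun x => a * f x) = a * cintegral mu f.
Proof.
move=> [f1 f2]; rewrite /cintegral.
have ZR b : mu.-integrable setT (EFin \o (fun x => b * Re (f x))).
  by have := integrableZl measurableT b f1; apply: eq_integrable.
have ZI b : mu.-integrable setT (EFin \o (fun x => b * Im (f x))).
  by have := integrableZl measurableT b f2; apply: eq_integrable.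
under eq_Rintegral do rewrite ReM -mulNr.
under [X in _ +i* X]eq_Rintegral do rewrite ImM.
rewrite !RintegralD// !RintegralZl//.
by apply/eqP; rewrite eq_complex ReM ImM/= mulNr !eqxx.
Qed.

Lemma cintegrableD f g : cintegrable mu f -> cintegrable mu g ->
  cintegrable mu (fun x => f x + g x).
Proof.
move=> [f1 f2] [g1 g2]; split.
  have := integrableD measurableT f1 g1; apply: eq_integrable => // x _ /=.
  by rewrite raddfD.
have := integrableD measurableT f2 g2; apply: eq_integrable => // x _ /=.
by rewrite raddfD.
Qed.

Lemma cintegrableZ a f : cintegrable mu f -> cintegrable mu (fun x => a * f x).
Proof.
move=> [f1 f2]; split.
  have := integrableD measurableT (integrableZl measurableT (Re a) f1)
    (integrableZl measurableT (- Im a) f2).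
  by apply: eq_integrable => // x _; rewrite ReM -mulNr.
have := integrableD measurableT (integrableZl measurableT (Re a) f2)
  (integrableZl measurableT (Im a) f1).
by apply: eq_integrable => // x _; rewrite ImM.
Qed.

Lemma cintegral0 : cintegral mu (fun=> 0) = 0.
Proof. by rewrite /cintegral !Rintegral_cst//= !mul0r. Qed.

Lemma cintegrable0 : cintegrable mu (fun=> 0).
Proof. by split; exact: integrable0. Qed.

Lemma cintegrable_sum (I : Type) (s : seq I) (F : I -> T -> R[i]) :
  (forall i, cintegrable mu (F i)) -> cintegrable mu (fun x => \sum_(i <- s) F i x).
Proof.
move=> HF; elim: s => [|i s IHs].
  by under eq_fun do rewrite big_nil; exact: cintegrable0.
by under eq_fun do rewrite big_cons; exact: cintegrableD.
Qed.

Lemma cintegral_sum (I : Type) (s : seq I) (F : I -> T -> R[i]) :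
  (forall i, cintegrable mu (F i)) ->
  cintegral mu (fun x => \sum_(i <- s) F i x) = \sum_(i <- s) cintegral mu (F i).
Proof.
move=> HF; elim: s => [|i s IHs].
  by under eq_fun do rewrite big_nil; rewrite cintegral0 big_nil.
under eq_fun do rewrite big_cons.
by rewrite cintegralD// ?IHs ?big_cons//; exact: cintegrable_sum.
Qed.

End ComplexIntegral.

(** * Partial derivatives of complex-valued functions of the real coordinates *)

Section ComplexDerivative.
Variables (R : realType) (m : nat).
Local Notation C := R[i].
Local Notation Re := (@complex.Re R).
Local Notation Im := (@complex.Im R).
Local Notation tup := (m.-tuple (measurableTypeR R)).
Local Notation T := (tup * tup)%type.
Local Notation mu := (lebesgue_tuple R m \x lebesgue_tuple R m)%E.
Implicit Types F G H : T -> C.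

Definition is_cderiv (j : 'I_m + 'I_m) F G : Prop := forall t s,
  is_derive s (1 : R) (fun s => Re (F (upd j s t))) (Re (G (upd j s t))) /\
  is_derive s (1 : R) (fun s => Im (F (upd j s t))) (Im (G (upd j s t))).

Lemma is_cderiv_cst j a : is_cderiv j (fun=> a) (fun=> 0).
Proof. by move=> t s; split; exact: is_derive_cst. Qed.

Lemma is_cderivD j F F' G G' : is_cderiv j F F' -> is_cderiv j G G' ->
  is_cderiv j (fun x => F x + G x) (fun x => F' x + G' x).
Proof.
move=> dF dG t s; have [F1 F2] := dF t s; have [G1 G2] := dG t s; split.
  have := is_deriveD F1 G1; rewrite -ReD; congr is_derive.
  by apply/funext => z; rewrite (ReD,ImD).
have := is_deriveD F2 G2; rewrite -ImD; congr is_derive.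
by apply/funext => z; rewrite (ReD,ImD).
Qed.

Lemma is_cderivM j F F' G G' : is_cderiv j F F' -> is_cderiv j G G' ->
  is_cderiv j (fun x => F x * G x) (fun x => F' x * G x + F x * G' x).
Proof.
move=> dF dG t s; have [F1 F2] := dF t s; have [G1 G2] := dG t s; split.
  have := is_deriveB (is_deriveM F1 G1) (is_deriveM F2 G2).
  rewrite (_ : _ - _ = (fun s => Re (F (upd j s t) * G (upd j s t)))); last first.
    by apply/funext => z; rewrite ReM.
  move=> h; apply: is_derive_eq h _; rewrite ReD !ReM /GRing.scale/=; ring.
have := is_deriveD (is_deriveM F1 G2) (is_deriveM F2 G1).
rewrite (_ : _ + _ = (fun s => Im (F (upd j s t) * G (upd j s t)))); last first.
  by apply/funext => z; rewrite ImM.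
by move=> h; apply: is_derive_eq h _; rewrite ImD !ImM /GRing.scale/=; ring.
Qed.

Lemma is_cderiv_cexp j F G : is_cderiv j F G ->
  is_cderiv j (fun x => cexp (F x)) (fun x => G x * cexp (F x)).
Proof.
move=> dF t s; have [F1 F2] := dF t s.
have dE := is_derive1_comp (is_derive_expR (Re (F (upd j s t)))) F1.
have dc := is_derive1_comp (is_derive_cos (Im (F (upd j s t)))) F2.
have ds := is_derive1_comp (is_derive_sin (Im (F (upd j s t)))) F2.
split.
  have := is_deriveM dE dc.
  rewrite (_ : _ * _ = (fun s => Re (cexp (F (upd j s t))))); last first.
    by apply/funext => z; rewrite Re_cexp.
  move=> h; apply: is_derive_eq h _; rewrite ReM Re_cexp Im_cexp /GRing.scale/=; ring.
have := is_deriveM dE ds.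
rewrite (_ : _ * _ = (fun s => Im (cexp (F (upd j s t))))); last first.
  by apply/funext => z; rewrite Im_cexp.
by move=> h; apply: is_derive_eq h _; rewrite ImM Re_cexp Im_cexp /GRing.scale/=; ring.
Qed.

Lemma is_cderiv_affine j (F : T -> C) a :
  (forall s t, F (upd j s t) = F t + (s - coord j t)%:C * a) ->
  is_cderiv j F (fun=> a).
Proof.
move=> HF t s; split.
  rewrite (_ : (fun _ => _) = (fun s => Re (F t) - coord j t * Re a) + (fun s => s * Re a)).
    have := is_deriveD (is_derive_cst (Re (F t) - coord j t * Re a) s (1 : R))
      (is_deriveM (is_derive_id s (1 : R)) (is_derive_cst (Re a) s (1 : R))).
    by move=> h; apply: is_derive_eq h _; rewrite scaler0 !add0r /GRing.scale/= mulr1.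
  apply/funext => z /=; rewrite HF ReD ReM/=.
  change (Re (F t) + ((z - coord j t) * Re a - 0 * Im a) =
    (Re (F t) - coord j t * Re a) + z * Re a); ring.
rewrite (_ : (fun _ => _) = (fun s => Im (F t) - coord j t * Im a) + (fun s => s * Im a)).
  have := is_deriveD (is_derive_cst (Im (F t) - coord j t * Im a) s (1 : R))
    (is_deriveM (is_derive_id s (1 : R)) (is_derive_cst (Im a) s (1 : R))).
  by move=> h; apply: is_derive_eq h _; rewrite scaler0 !add0r /GRing.scale/= mulr1.
apply/funext => z /=; rewrite HF ImD ImM/=.
change (Im (F t) + ((z - coord j t) * Im a + 0 * Re a) =
  (Im (F t) - coord j t * Im a) + z * Im a); ring.
Qed.

Lemma cintegral_cderiv0 j F G H : is_cderiv j F G -> is_cderiv j G H ->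
  cdecays F -> cdecays G -> cintegral mu G = 0.
Proof.
move=> dF dG [F1 F2] [G1 G2].
have sq k : k%:R <= k%:R ^+ 2 :> R by rewrite -natrX ler_nat; case: k => // k; rewrite leq_pmulr.
have sqN k : k%:R <= (- k%:R) ^+ 2 :> R by rewrite sqrrN.
rewrite /cintegral /Rintegral.
have I1 := @upd_integrates_derivatives_to0 R m j (Re \o F) (Re \o G) (Re \o H)
  (decays_integrable G1) (fun t s => (dF t s).1) (fun t s => (dG t s).1)
  (fun t => decays_cvg0 j t F1 sq) (fun t => decays_cvg0 j t F1 sqN).
have I2 := @upd_integrates_derivatives_to0 R m j (Im \o F) (Im \o G) (Im \o H)
  (decays_integrable G2) (fun t s => (dF t s).2) (fun t s => (dG t s).2)
  (fun t => decays_cvg0 j t F2 sq) (fun t => decays_cvg0 j t F2 sqN).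
by move: I1 I2 => /= -> ->.
Qed.

End ComplexDerivative.

(** * Polynomials in the matrix entries and the Wick recursion *)

Section EntryPolynomials.
Variables (R : realType) (n : nat).
Local Notation C := R[i].
Local Notation M := 'M[C]_n.
Local Notation V := (bool * 'I_n * 'I_n)%type.
Implicit Types (v : V) (w : seq V) (p : M * M).

(* [(true, i, j)] stands for [A i j] and [(false, i, j)] for [B i j]. *)
Definition entry v p : C := (if v.1.1 then p.1 else p.2) v.1.2 v.2.

Definition word w p : C := \prod_(v <- w) entry v p.

(** A property of functions whose witness is a list of weighted words; [entry_sum_moment] later
    turns this list into a polynomial in the ratios. *)
Definition entry_polynomial (F : M * M -> C) : Prop :=
  exists s : seq (C * seq V), forall p, F p = \sum_(q <- s) q.1 * word q.2 p.

Lemma entry_polynomial_word w : entry_polynomial (word w).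
Proof. by exists [:: (1, w)] => p; rewrite big_seq1 mul1r. Qed.

Lemma entry_polynomial_entry v : entry_polynomial (entry v).
Proof. by exists [:: (1, [:: v])] => p; rewrite big_seq1 mul1r /word big_seq1. Qed.

Lemma entry_polynomial_cst a : entry_polynomial (fun=> a).
Proof. by exists [:: (a, [::])] => p; rewrite big_seq1 /word big_nil mulr1. Qed.

Lemma entry_polynomialD F G : entry_polynomial F -> entry_polynomial G ->
  entry_polynomial (fun p => F p + G p).
Proof. by move=> [s Hs] [t Ht]; exists (s ++ t) => p; rewrite big_cat Hs Ht. Qed.

Lemma entry_polynomialM F G : entry_polynomial F -> entry_polynomial G ->
  entry_polynomial (fun p => F p * G p).
Proof.
move=> [s Hs] [t Ht].
exists [seq (q.1 * r.1, q.2 ++ r.2) | q <- s, r <- t] => p.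
rewrite Hs Ht big_allpairs_dep mulr_suml; apply: eq_bigr => q _.
rewrite mulr_sumr; apply: eq_bigr => r _ /=.
by rewrite /word big_cat/= mulrACA.
Qed.

Lemma entry_polynomial_sum (I : Type) (r : seq I) (F : I -> M * M -> C) :
  (forall i, entry_polynomial (F i)) ->
  entry_polynomial (fun p => \sum_(i <- r) F i p).
Proof.
move=> HF; elim: r => [|i r IHr].
  by under eq_fun do rewrite big_nil; exact: entry_polynomial_cst.
by under eq_fun do rewrite big_cons; exact: entry_polynomialD.
Qed.

Lemma entry_polynomial_prod (I : Type) (r : seq I) (F : I -> M * M -> C) :
  (forall i, entry_polynomial (F i)) ->
  entry_polynomial (fun p => \prod_(i <- r) F i p).
Proof.
move=> HF; elim: r => [|i r IHr].
  by under eq_fun do rewrite big_nil; exact: entry_polynomial_cst.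
by under eq_fun do rewrite big_cons; exact: entry_polynomialM.
Qed.

Definition entrywise_polynomial (F : M * M -> M) : Prop :=
  forall i j, entry_polynomial (fun p => F p i j).

Lemma entrywise_polynomial1 : entrywise_polynomial (fun=> 1).
Proof. by move=> i j; exact: entry_polynomial_cst. Qed.

Lemma entrywise_polynomialM F G : entrywise_polynomial F -> entrywise_polynomial G ->
  entrywise_polynomial (fun p => F p * G p).
Proof.
move=> HF HG i j; under eq_fun do rewrite mxE.
by apply: entry_polynomial_sum => k; exact: entry_polynomialM.
Qed.

Lemma entrywise_polynomialX F k : entrywise_polynomial F ->
  entrywise_polynomial (fun p => F p ^+ k).
Proof.
move=> HF; elim: k => [|k IHk]; first exact: entrywise_polynomial1.
by under eq_fun do rewrite exprS; exact: entrywise_polynomialM.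
Qed.

Lemma entry_polynomial_trace F : entrywise_polynomial F ->
  entry_polynomial (fun p => \tr (F p)).
Proof. by move=> HF; apply: entry_polynomial_sum => i; exact: HF. Qed.

Lemma entry_polynomial_invariant_monomial l :
  entry_polynomial (fun p => invariant_monomial l p.1 p.2).
Proof.
apply: entry_polynomial_prod => t; apply: entry_polynomial_trace.
elim: t => [|kl t IHt].
  by under eq_fun do rewrite big_nil; exact: entrywise_polynomial1.
under eq_fun do rewrite big_cons.
apply: entrywise_polynomialM IHt; apply: entrywise_polynomialM;
  apply: entrywise_polynomialX => i j.
- exact: (entry_polynomial_entry (true, i, j)).
- exact: (entry_polynomial_entry (false, i, j)).
Qed.

Lemma entry_polynomial_invariant F : polynomial_invariant F ->
  entry_polynomial (fun p => F p.1 p.2).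
Proof.
move=> [N [c [G [HG HF]]]]; under eq_fun do rewrite HF.
apply: entry_polynomial_sum => i; apply: entry_polynomialM.
  exact: entry_polynomial_cst.
have [l _ Gl] := HG i; under eq_fun do rewrite Gl.
exact: entry_polynomial_invariant_monomial.
Qed.

End EntryPolynomials.

Section Wick.
Variables (R : realType) (n : nat).
Local Notation C := R[i].
Local Notation V := (bool * 'I_n * 'I_n)%type.

(** All ways of splitting one letter off a word. Summing over them gives both the Leibniz rule for a
    product of entries and the choice of a partner in a Wick pairing. *)
Fixpoint picks (T : Type) (w : seq T) : seq (T * seq T) :=
  if w is v :: w' then (v, w') :: [seq (q.1, v :: q.2) | q <- picks w'] else [::].

Lemma size_picks (T : eqType) (w : seq T) q : q \in picks w -> size w = (size q.2).+1.
Proof.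
elim: w q => [//|v w IHw] q; rewrite inE => /predU1P[-> //|/mapP[r rw ->]] /=.
by rewrite (IHw _ rw).
Qed.

Local Notation X i := (@mpoly.mpolyX 3 C (mpoly.mnm1 i)).

(** The variables 0, 1, 2 stand for [a1 / delta], [a2 / delta], [g / delta]. The coefficients are
    those of the inverse of the symmetric matrix [[[a1, g], [g, a2]]], which is why [a2] goes with
    two letters [A]; the indices are transposed because a trace pairs the entry [(i, j)] with
    [(j, i)]. *)
Definition covariance (v u : V) : mpoly.mpoly 3 C :=
  if (v.1.2 == u.2) && (v.2 == u.1.2) then
    if v.1.1 then if u.1.1 then X (inord 1) else - X (inord 2)
    else if u.1.1 then - X (inord 2) else X (inord 0)
  else 0.

(* [wick k w] is the sum over all pairings of [w] of the products of covariances,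
   provided that [size w <= k]. *)
Fixpoint wick (k : nat) (w : seq V) : mpoly.mpoly 3 C :=
  match k, w with
  | _, [::] => 1
  | 0, _ :: _ => 0
  | k'.+1, v :: w' => \sum_(q <- picks w') covariance v q.1 * wick k' q.2
  end.

Definition eval_covariance (a1 a2 g : C) (v u : V) : C :=
  if (v.1.2 == u.2) && (v.2 == u.1.2) then
    (if v.1.1 then if u.1.1 then a2 else - g else if u.1.1 then - g else a1)
      / delta a1 a2 g
  else 0.

Lemma eval_ratiosM a1 a2 g (P Q : mpoly.mpoly 3 C) :
  eval_ratios (P * Q) a1 a2 g = eval_ratios P a1 a2 g * eval_ratios Q a1 a2 g.
Proof. exact: rmorphM. Qed.

Lemma eval_ratios_sum a1 a2 g (I : Type) (r : seq I) (P : I -> mpoly.mpoly 3 C) :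
  eval_ratios (\sum_(i <- r) P i) a1 a2 g = \sum_(i <- r) eval_ratios (P i) a1 a2 g.
Proof. exact: raddf_sum. Qed.

Lemma eval_ratios_covariance a1 a2 g v u :
  eval_ratios (covariance v u) a1 a2 g = eval_covariance a1 a2 g v u.
Proof.
rewrite /covariance /eval_covariance; case: ifP => _; last exact: raddf0.
rewrite /eval_ratios; case: v.1.1; case: u.1.1;
  by rewrite ?raddfN/= mpoly.mevalXU (tnth_nth 0) inordK//= mulNr.
Qed.

End Wick.

(** * Gaussian ensembles *)

Section GaussianEnsemble.
Variables (R : realType) (n : nat).
Local Notation C := R[i].
Local Notation Re := (@complex.Re R).
Local Notation Im := (@complex.Im R).
Local Notation M := 'M[C]_n.
Local Notation V := (bool * 'I_n * 'I_n)%type.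
Local Notation coords := ((n * n).-tuple (measurableTypeR R)).
Local Notation T := (coords * coords)%type.
Local Notation I := ('I_(n * n) + 'I_(n * n))%type.
Local Notation mu := (lebesgue_coords2 R n).

Definition coord_linear (f : T -> C) : Prop :=
  exists c : I -> C, forall x, f x = \sum_j (coord j x)%:C * c j.

Definition action (a1 a2 g : C) (p : M * M) : C :=
  \tr ((a1 / 2) *: p.1 ^+ 2 + (a2 / 2) *: p.2 ^+ 2 + g *: (p.1 * p.2)).

Lemma actionE a1 a2 g p : action a1 a2 g p =
  \sum_i \sum_j (a1 / 2 * (p.1 i j * p.1 j i) + a2 / 2 * (p.2 i j * p.2 j i) +
                 g * (p.1 i j * p.2 j i)).
Proof.
rewrite /action /mxtrace; apply: eq_bigr => i _.
rewrite !mxE !mulr_sumr -!big_split /=.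
by apply: eq_bigr => j _.
Qed.

(* Half of [polar] at [u] and the entries of [p] is the polarization of [action]. *)
Definition polar (a1 a2 g : C) (u : V -> C) (p : M * M) : C :=
  \sum_i \sum_j (u (true, i, j) * (a1 * p.1 j i + g * p.2 j i) +
                 u (false, i, j) * (a2 * p.2 j i + g * p.1 j i)).

Variable e : T -> M * M.
Hypothesis e_linear : forall v, coord_linear (fun x => entry v (e x)).

(** The form in which both parameter domains enter the argument: it gives Gaussian decay of the
    weight and [delta != 0], and it persists along the deformation to a real action. *)
Definition coercive (a1 a2 g : C) : Prop := exists2 eps : R, 0 < eps &
  forall x, eps * sqnorm2 x <= Re (action a1 a2 g (e x)).

Lemma csubgauss_sum (K : Type) (r : seq K) (F : K -> T -> C) :
  (forall k, csubgauss (F k)) -> csubgauss (fun x => \sum_(k <- r) F k x).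
Proof.
move=> HF; elim: r => [|k r IHr].
  by under eq_fun do rewrite big_nil; exact: csubgauss_cst.
by under eq_fun do rewrite big_cons; exact: csubgaussD.
Qed.

Lemma csubgauss_prod (K : Type) (r : seq K) (F : K -> T -> C) :
  (forall k, csubgauss (F k)) -> csubgauss (fun x => \prod_(k <- r) F k x).
Proof.
move=> HF; elim: r => [|k r IHr].
  by under eq_fun do rewrite big_nil; exact: csubgauss_cst.
by under eq_fun do rewrite big_cons; exact: csubgaussM.
Qed.

Lemma csubgauss_coord j : csubgauss (fun x : T => (coord j x)%:C).
Proof.
split; last exact: subgauss_cst.
by apply: subgauss_of_sqr_le => [|x]; [exact: measurable_coord|exact: sqr_coord_le].
Qed.

Lemma csubgauss_entry v : csubgauss (fun x => entry v (e x)).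
Proof.
have [c Hc] := e_linear v; under eq_fun do rewrite Hc.
apply: csubgauss_sum => j; by apply: csubgaussM; [exact: csubgauss_coord|exact: csubgauss_cst].
Qed.

Lemma csubgauss_entry_polynomial F : entry_polynomial F -> csubgauss (fun x => F (e x)).
Proof.
move=> [s Hs]; under eq_fun do rewrite Hs.
apply: csubgauss_sum => q; apply: csubgaussM; first exact: csubgauss_cst.
by apply: csubgauss_prod => v; exact: csubgauss_entry.
Qed.

Lemma entry_polynomial_action a1 a2 g : entry_polynomial (action a1 a2 g).
Proof.
have PE b i j := @entry_polynomial_entry R n (b, i, j).
suff : entry_polynomial (fun p => action a1 a2 g p) by [].
under eq_fun do rewrite actionE.
apply: entry_polynomial_sum => i; apply: entry_polynomial_sum => j.
apply: entry_polynomialD; first apply: entry_polynomialD;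
  (apply: entry_polynomialM; [exact: entry_polynomial_cst|apply: entry_polynomialM]).
- exact: (PE true).
- exact: (PE true).
- exact: (PE false).
- exact: (PE false).
- exact: (PE true).
- exact: (PE false).
Qed.

Lemma entry_polynomial_polar a1 a2 g u : entry_polynomial (polar a1 a2 g u).
Proof.
have PE b i j := @entry_polynomial_entry R n (b, i, j).
apply: entry_polynomial_sum => i; apply: entry_polynomial_sum => j.
apply: entry_polynomialD; apply: entry_polynomialM;
  (try exact: entry_polynomial_cst);
  apply: entry_polynomialD; apply: entry_polynomialM;
  (try exact: entry_polynomial_cst).
- exact: (PE true).
- exact: (PE false).
- exact: (PE false).
- exact: (PE true).
Qed.

Lemma weight_atE a1 a2 g x : weight_at e a1 a2 g x = cexp (- action a1 a2 g (e x)).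
Proof. by []. Qed.

Lemma cdecays_weight a1 a2 g : coercive a1 a2 g -> cdecays (weight_at e a1 a2 g).
Proof.
move=> [eps eps0 Heps].
have [[mR _] [mI _]] := csubgauss_entry_polynomial (entry_polynomial_action a1 a2 g).
have b x : expR (Re (- action a1 a2 g (e x))) <= 1 * expR (- (eps * sqnorm2 x)).
  by rewrite mul1r ler_expR raddfN lerN2.
have mNR := measurable_funN mR; have mNI := measurable_funN mI.
split; split; try (exists 1, eps; split=> // x).
- rewrite (_ : _ \o _ = fun x => expR (- Re (action a1 a2 g (e x))) *
      cos (- Im (action a1 a2 g (e x)))).
    apply: measurable_funM; first exact: measurableT_comp.
    exact: (measurableT_comp (continuous_measurable_fun (@continuous_cos R)) mNI).
  by apply/funext => x; rewrite -[LHS]/(Re (cexp _)) Re_cexp !raddfN.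
- rewrite -[X in `|X|]/(Re (cexp _)) Re_cexp normrM (ger0_norm (expR_ge0 _)).
  by apply: le_trans (b x); rewrite ler_piMr ?expR_ge0// ler_norml cos_geN1 cos_le1.
- rewrite (_ : _ \o _ = fun x => expR (- Re (action a1 a2 g (e x))) *
      sin (- Im (action a1 a2 g (e x)))).
    apply: measurable_funM; first exact: measurableT_comp.
    exact: (measurableT_comp (continuous_measurable_fun (@continuous_sin R)) mNI).
  by apply/funext => x; rewrite -[LHS]/(Im (cexp _)) Im_cexp !raddfN.
- rewrite -[X in `|X|]/(Im (cexp _)) Im_cexp normrM (ger0_norm (expR_ge0 _)).
  by apply: le_trans (b x); rewrite ler_piMr ?expR_ge0// ler_norml sin_geN1 sin_le1.
Qed.

Lemma cdecays_weighted F a1 a2 g : entry_polynomial F -> coercive a1 a2 g ->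
  cdecays (fun x => F (e x) * weight_at e a1 a2 g x).
Proof.
move=> HF Hc; apply: csubgauss_cdecays (cdecays_weight Hc).
exact: csubgauss_entry_polynomial.
Qed.

Lemma cintegrable_weighted F a1 a2 g : entry_polynomial F -> coercive a1 a2 g ->
  cintegrable mu (fun x => F (e x) * weight_at e a1 a2 g x).
Proof. by move=> HF Hc; apply: cdecays_cintegrable; exact: cdecays_weighted. Qed.

End GaussianEnsemble.

(** * Integration by parts for moments, in real and then in complex directions *)

Section WickTheorem.
Variables (R : realType) (n : nat).
Local Notation C := R[i].
Local Notation Re := (@complex.Re R).
Local Notation Im := (@complex.Im R).
Local Notation M := 'M[C]_n.
Local Notation V := (bool * 'I_n * 'I_n)%type.
Local Notation coords := ((n * n).-tuple (measurableTypeR R)).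
Local Notation T := (coords * coords)%type.
Local Notation I := ('I_(n * n) + 'I_(n * n))%type.
Local Notation mu := (lebesgue_coords2 R n).

Lemma eq_is_cderiv j (F F' G G' : T -> C) : F =1 G -> F' =1 G' ->
  is_cderiv j F F' -> is_cderiv j G G'.
Proof. by move=> /funext -> /funext ->. Qed.

Lemma is_cderiv_sum (K : Type) (r : seq K) (F F' : K -> T -> C) j :
  (forall k, is_cderiv j (F k) (F' k)) ->
  is_cderiv j (fun x => \sum_(k <- r) F k x) (fun x => \sum_(k <- r) F' k x).
Proof.
move=> HF; elim: r => [|k r IHr].
  by apply: eq_is_cderiv (is_cderiv_cst j 0) => x; rewrite big_nil.
by apply: eq_is_cderiv (is_cderivD (HF k) IHr) => x; rewrite big_cons.
Qed.

Lemma is_cderivMl j (a : C) (F F' : T -> C) : is_cderiv j F F' ->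
  is_cderiv j (fun x => a * F x) (fun x => a * F' x).
Proof.
move=> dF; apply: eq_is_cderiv (is_cderivM (is_cderiv_cst j a) dF) => x //.
by rewrite mul0r add0r.
Qed.

Definition word_deriv (u : V -> C) (w : seq V) (p : M * M) : C :=
  \sum_(q <- picks w) u q.1 * word q.2 p.

Lemma word_deriv_cons u v w p :
  word_deriv u (v :: w) p = u v * word w p + entry v p * word_deriv u w p.
Proof.
rewrite /word_deriv big_cons big_map mulr_sumr; congr (_ + _).
by apply: eq_bigr => q _; rewrite /word big_cons mulrCA.
Qed.

Variables (e : T -> M * M) (c : V -> I -> C).
Hypothesis eE : forall v x, entry v (e x) = \sum_j (coord j x)%:C * c v j.
Hypothesis e_span : forall u : V -> C, exists x y, forall v,
  entry v (e x) + 'i * entry v (e y) = u v.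

Let e_linear v : coord_linear (fun x => entry v (e x)).
Proof. by exists (c v). Qed.

Lemma is_cderiv_entry j v : is_cderiv j (fun x => entry v (e x)) (fun=> c v j).
Proof.
apply: is_cderiv_affine => s t; rewrite !eE (bigD1 j)//= [in RHS](bigD1 j)//=.
have sE : s%:C = (coord j t)%:C + (s - coord j t)%:C by rewrite -rmorphD/= addrC subrK.
rewrite coord_upd eqxx addrAC -mulrDl -sE; congr (_ + _).
by apply: eq_bigr => k /negbTE kj; rewrite coord_upd kj.
Qed.

Lemma is_cderiv_word j w :
  is_cderiv j (fun x => word w (e x)) (fun x => word_deriv (c ^~ j) w (e x)).
Proof.
elim: w => [|v w IHw].
  apply: eq_is_cderiv (is_cderiv_cst j 1) => x; first by rewrite /word big_nil.
  by rewrite /word_deriv big_nil.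
apply: eq_is_cderiv (is_cderivM (is_cderiv_entry j v) IHw) => x.
  by rewrite /word big_cons.
by rewrite word_deriv_cons.
Qed.

(** Only the existence of the derivative is used: it supplies the second derivative that the
    integration by parts asks for. *)
Lemma is_cderiv_entry_polynomial j F : entry_polynomial F ->
  exists G, is_cderiv j (fun x => F (e x)) G.
Proof.
move=> [s Hs].
exists (fun x => \sum_(q <- s) q.1 * word_deriv (c ^~ j) q.2 (e x)).
apply: (eq_is_cderiv (fun x => esym (Hs (e x))) (fun=> erefl)).
by apply: is_cderiv_sum => q; apply: is_cderivMl; exact: is_cderiv_word.
Qed.

Lemma is_cderiv_action a1 a2 g j : is_cderiv j (fun x => action a1 a2 g (e x))
  (fun x => polar a1 a2 g (c ^~ j) (e x)).
Proof.
have dE b i k := is_cderiv_entry j (b, i, k).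
have dsum : is_cderiv j (fun x => action a1 a2 g (e x)) (fun x => \sum_i \sum_k
    (a1 / 2 * (c (true, i, k) j * (e x).1 k i + (e x).1 i k * c (true, k, i) j) +
     a2 / 2 * (c (false, i, k) j * (e x).2 k i + (e x).2 i k * c (false, k, i) j) +
     g * (c (true, i, k) j * (e x).2 k i + (e x).1 i k * c (false, k, i) j))).
  apply: (eq_is_cderiv (fun x => esym (actionE a1 a2 g (e x))) (fun=> erefl)).
  apply: is_cderiv_sum => i; apply: is_cderiv_sum => k.
  apply: is_cderivD; first apply: is_cderivD; apply: is_cderivMl.
  - exact: is_cderivM (dE true i k) (dE true k i).
  - exact: is_cderivM (dE false i k) (dE false k i).
  - exact: is_cderivM (dE true i k) (dE false k i).
apply: (eq_is_cderiv (fun=> erefl) _ dsum) => x; rewrite /polar.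
pose A1 := \sum_i \sum_k c (true, i, k) j * (e x).1 k i.
pose A2 := \sum_i \sum_k c (false, i, k) j * (e x).2 k i.
pose A3 := \sum_i \sum_k c (true, i, k) j * (e x).2 k i.
pose A4 := \sum_i \sum_k c (false, i, k) j * (e x).1 k i.
transitivity (a1 * A1 + a2 * A2 + g * (A3 + A4)); last first.
  rewrite mulrDr !mulr_sumr -!big_split/=; apply: eq_bigr => i _.
  rewrite !mulr_sumr -!big_split/=; apply: eq_bigr => k _; ring.
(* The product rule produces bilinear sums in both index orders; exchanging the two summations
   merges them and cancels the factors [1 / 2]. *)
have sw b b' : \sum_i \sum_k (if b' then (e x).1 else (e x).2) i k * c (b, k, i) j =
    \sum_i \sum_k c (b, i, k) j * (if b' then (e x).1 else (e x).2) k i.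
  by rewrite exchange_big/=; apply: eq_bigr => i _; apply: eq_bigr => k _; rewrite mulrC.
transitivity (a1 / 2 * (A1 + A1) + a2 / 2 * (A2 + A2) + g * (A3 + A4)); last by field.
rewrite -[X in a1 / 2 * (_ + X)](sw true true) -[X in a2 / 2 * (_ + X)](sw false false).
rewrite -[X in _ + g * (_ + X)](sw false true).
rewrite -!big_split/= !mulr_sumr -!big_split/=; apply: eq_bigr => i _.
by rewrite -!big_split/= !mulr_sumr -!big_split/=; apply: eq_bigr => k _.
Qed.

Definition moment a1 a2 g (w : seq V) : C :=
  cintegral mu (fun x => word w (e x) * weight_at e a1 a2 g x).

Variables a1 a2 g : C.
Hypothesis e_coercive : coercive e a1 a2 g.
Local Notation J := (moment a1 a2 g).
Local Notation wt := (weight_at e a1 a2 g).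

Definition moment_polar (u : V -> C) (w : seq V) : C :=
  \sum_i \sum_j (u (true, i, j) * (a1 * J ((true, j, i) :: w) + g * J ((false, j, i) :: w)) +
   u (false, i, j) * (a2 * J ((false, j, i) :: w) + g * J ((true, j, i) :: w))).

Lemma cintegral_word_polar u w :
  cintegral mu (fun x => word w (e x) * polar a1 a2 g u (e x) * wt x) = moment_polar u w.
Proof.
have iw v : cintegrable mu (fun x => word (v :: w) (e x) * wt x).
  exact: (cintegrable_weighted e_linear (entry_polynomial_word R _) e_coercive).
pose G i j x := u (true, i, j) * (a1 * (word ((true, j, i) :: w) (e x) * wt x) +
    g * (word ((false, j, i) :: w) (e x) * wt x)) +
   u (false, i, j) * (a2 * (word ((false, j, i) :: w) (e x) * wt x) +
    g * (word ((true, j, i) :: w) (e x) * wt x)).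
have iG i j : cintegrable mu (G i j).
  by do ?[apply: cintegrableD|apply: cintegrableZ].
rewrite (_ : (fun x => _) = (fun x => \sum_i \sum_j G i j x)); last first.
  apply/funext => x; rewrite /polar mulr_sumr mulr_suml; apply: eq_bigr => i _.
  rewrite mulr_sumr mulr_suml; apply: eq_bigr => j _.
  rewrite /G /word !big_cons /entry/=; ring.
rewrite cintegral_sum => [|i]; last exact: cintegrable_sum.
apply: eq_bigr => i _; rewrite cintegral_sum//; apply: eq_bigr => j _.
by rewrite /G cintegralD ?cintegralZ ?cintegralD ?cintegralZ//;
  do ?[apply: cintegrableD|apply: cintegrableZ].
Qed.

Lemma moment_ibp_coord j w :
  \sum_(q <- picks w) c q.1 j * J q.2 = moment_polar (c ^~ j) w.
Proof.
(* [P] times the weight is the derivative of [word w] times the weight: the Leibniz rule on the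
   word, minus the derivative of the action. *)
pose P p := word_deriv (c ^~ j) w p - word w p * polar a1 a2 g (c ^~ j) p.
have epP : entry_polynomial P.
  apply: entry_polynomialD.
    apply: entry_polynomial_sum => q.
    by apply: entry_polynomialM; [exact: entry_polynomial_cst|exact: entry_polynomial_word].
  suff : entry_polynomial (fun p => -1 * (word w p * polar a1 a2 g (c ^~ j) p)).
    by under eq_fun do rewrite mulN1r.
  apply: entry_polynomialM; first exact: entry_polynomial_cst.
  apply: entry_polynomialM; first exact: entry_polynomial_word.
  exact: entry_polynomial_polar.
have dwt : is_cderiv j wt (fun x => - polar a1 a2 g (c ^~ j) (e x) * wt x).
  apply: is_cderiv_cexp.
  by apply: eq_is_cderiv (is_cderivMl (-1) (is_cderiv_action a1 a2 g j)) => x;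
    rewrite mulN1r.
have [P' dP] := is_cderiv_entry_polynomial j epP.
have d1 : is_cderiv j (fun x => word w (e x) * wt x) (fun x => P (e x) * wt x).
  have := is_cderivM (is_cderiv_word j w) dwt.
  apply: eq_is_cderiv => // x; rewrite /P; ring.
have := cintegral_cderiv0 d1 (is_cderivM dP dwt)
  (cdecays_weighted e_linear (entry_polynomial_word R w) e_coercive)
  (cdecays_weighted e_linear epP e_coercive).
rewrite (_ : (fun x => P (e x) * wt x) = (fun x =>
    \sum_(q <- picks w) c q.1 j * (word q.2 (e x) * wt x) +
    -1 * (word w (e x) * polar a1 a2 g (c ^~ j) (e x) * wt x))); last first.
  apply/funext => x; rewrite /P mulrBl mulN1r /word_deriv mulr_suml; congr (_ - _).
  by apply: eq_bigr => q _; rewrite mulrA.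
have iq w' : cintegrable mu (fun x => word w' (e x) * wt x).
  exact: (cintegrable_weighted e_linear (entry_polynomial_word R _) e_coercive).
have ip : cintegrable mu (fun x => word w (e x) * polar a1 a2 g (c ^~ j) (e x) * wt x).
  apply: (cintegrable_weighted (F := fun p => word w p * polar a1 a2 g (c ^~ j) p)
    e_linear _ e_coercive).
  by apply: entry_polynomialM; [exact: entry_polynomial_word|exact: entry_polynomial_polar].
rewrite [cintegral _ _](_ : _ = \sum_(q <- picks w) c q.1 j * J q.2
    - moment_polar (c ^~ j) w); first by move/subr0_eq.
rewrite -cintegral_word_polar -[- cintegral _ _]mulN1r -cintegralZ//.
rewrite [LHS]cintegralD; last 2 first.
- by apply: cintegrable_sum => q; exact: cintegrableZ.
- exact: cintegrableZ.
rewrite cintegral_sum => [|q]; last exact: cintegrableZ.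
by congr (_ + _); apply: eq_bigr => q _; rewrite cintegralZ.
Qed.

Lemma moment_ibp (u : V -> C) w :
  \sum_(q <- picks w) u q.1 * J q.2 = moment_polar u w.
Proof.
have [x [y Hxy]] := e_span u.
(* The complex coordinates of the direction [u]: it is the combination of the real coordinate
   directions [c ^~ j] with coefficients [d j], and both sides are linear in [u]. *)
pose d j : C := (coord j x)%:C + 'i * (coord j y)%:C.
have uE v : u v = \sum_j d j * c v j.
  rewrite -Hxy !eE mulr_sumr -big_split/=; apply: eq_bigr => j _.
  by rewrite mulrDl mulrA.
transitivity (\sum_j d j * \sum_(q <- picks w) c q.1 j * J q.2).
  under [RHS]eq_bigr do rewrite mulr_sumr.
  rewrite exchange_big/=; apply: eq_bigr => q _.
  by rewrite uE mulr_suml; apply: eq_bigr => j _; rewrite mulrA.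
under eq_bigr do rewrite moment_ibp_coord.
rewrite /moment_polar; under eq_bigr do rewrite mulr_sumr.
rewrite exchange_big/=; apply: eq_bigr => i _.
under eq_bigr do rewrite mulr_sumr.
rewrite exchange_big/=; apply: eq_bigr => k _.
rewrite !uE !mulr_suml -big_split/=; apply: eq_bigr => j _.
by rewrite mulrDr !mulrA.
Qed.

End WickTheorem.

Lemma ge0_sum_eq0 (R : realDomainType) (p q a b : R) :
  0 <= p -> 0 <= q -> p <= a -> q <= b -> a + b = 0 -> p = 0 /\ q = 0.
Proof. by split; lra. Qed.

(** * The moments as universal polynomials in the ratios times the partition function *)

Section MomentFormula.
Variables (R : realType) (n : nat).
Local Notation C := R[i].
Local Notation Re := (@complex.Re R).
Local Notation Im := (@complex.Im R).
Local Notation M := 'M[C]_n.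
Local Notation V := (bool * 'I_n * 'I_n)%type.
Local Notation coords := ((n * n).-tuple (measurableTypeR R)).
Local Notation T := (coords * coords)%type.
Local Notation mu := (lebesgue_coords2 R n).

Variable e : T -> M * M.
Hypothesis e_linear : forall v, coord_linear (fun x => entry v (e x)).
Hypothesis e_span : forall u : V -> C, exists x y, forall v,
  entry v (e x) + 'i * entry v (e y) = u v.

Section FixedParameters.
Variables a1 a2 g : C.
Hypothesis e_coercive : coercive e a1 a2 g.
Local Notation J := (moment e a1 a2 g).

Lemma sum2_eq1 (K : 'I_n -> 'I_n -> C) i j :
  (forall i' j', ~~ ((i' == i) && (j' == j)) -> K i' j' = 0) ->
  \sum_i' \sum_j' K i' j' = K i j.
Proof.
move=> HK; rewrite (bigD1 i)//= (bigD1 j)//= !big1 ?addr0//.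
- by move=> i' i'i; rewrite big1// => j' _; apply: HK; rewrite (negbTE i'i).
- by move=> j' j'j; apply: HK; rewrite (negbTE j'j) andbF.
Qed.

Lemma moment_cons v w : delta a1 a2 g != 0 ->
  J (v :: w) = \sum_(q <- picks w) eval_covariance a1 a2 g v q.1 * J q.2.
Proof.
move=> d0; have [c Hc] := choice e_linear.
(* The direction is [eval_covariance a1 a2 g v], supported at the transposed index [(l, k)]. There
   the combination of [a1], [a2], [g] with the covariances collapses to [delta / delta] times the
   moment of [v :: w]. *)
rewrite (moment_ibp Hc e_span e_coercive) /moment_polar.
case: v => [[b k] l].
rewrite (@sum2_eq1 _ l k) => [|i j]; last first.
  rewrite negb_and /eval_covariance/= => /orP[] /negbTE h.
    by rewrite [l == i]eq_sym h andbF !mul0r addr0.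
  by rewrite [k == j]eq_sym h !mul0r addr0.
rewrite /eval_covariance/= !eqxx /=; case: b; move: d0; rewrite /delta => d0.
  by field.
by field.
Qed.

Lemma moment_wick k w : delta a1 a2 g != 0 -> (size w <= k)%N ->
  J w = eval_ratios (wick R k w) a1 a2 g * J [::].
Proof.
move=> d0; elim: k w => [|k IHk] [|v w] //= sw; try by rewrite /eval_ratios rmorph1 mul1r.
rewrite moment_cons// eval_ratios_sum mulr_suml [LHS]big_seq [RHS]big_seq.
apply: eq_bigr => q qw; rewrite eval_ratiosM eval_ratios_covariance -mulrA -IHk//.
by move: sw; rewrite (size_picks qw) ltnS; exact: ltnW.
Qed.

Lemma polarC (x y : M * M) : polar a1 a2 g (fun v => entry v x) y =
 
  polar a1 a2 g (fun v => entry v y) x.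
Proof.
rewrite /polar/entry/= [RHS]exchange_big/=.
apply: eq_bigr => i _; apply: eq_bigr => j _; ring.
Qed.

Lemma polar_diag (x : M * M) : polar a1 a2 g (fun v => entry v x) x = 2 * action a1 a2 g x.
Proof.
rewrite actionE /polar/entry/=.
pose S (A B : M) := \sum_i \sum_j A i j * B j i.
have SC A B : S A B = S B A.
  by rewrite /S exchange_big/=; apply: eq_bigr => i _; apply: eq_bigr => j _; rewrite mulrC.
transitivity (a1 * S x.1 x.1 + a2 * S x.2 x.2 + g * (S x.1 x.2 + S x.2 x.1)).
  rewrite /S -big_split/= !mulr_sumr -!big_split/=; apply: eq_bigr => i _.
  by rewrite -big_split/= !mulr_sumr -!big_split/=; apply: eq_bigr => j _; ring.
rewrite (SC x.2) (_ : a1 * _ + _ + _ = 2 * (a1 / 2 * S x.1 x.1 + a2 / 2 * S x.2 x.2 + g * S x.1 x.2)); last by field.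
congr (_ * _); rewrite /S !mulr_sumr -!big_split/=; apply: eq_bigr => i _.
by rewrite !mulr_sumr -!big_split.
Qed.

Lemma eq_polar (u u' : V -> C) p : u =1 u' -> polar a1 a2 g u p = polar a1 a2 g u' p.
Proof.
by move=> uu'; apply: eq_bigr => i _; apply: eq_bigr => j _; rewrite !uu'.
Qed.

Lemma polarDi (u u' : V -> C) p : polar a1 a2 g (fun v => u v + 'i * u' v) p =
  polar a1 a2 g u p + 'i * polar a1 a2 g u' p.
Proof.
rewrite /polar mulr_sumr -big_split/=; apply: eq_bigr => i _.
rewrite mulr_sumr -big_split/=; apply: eq_bigr => j _; ring.
Qed.

Lemma sqnorm2_eq0_entry v x : sqnorm2 x = 0 -> entry v (e x) = 0.
Proof.
move=> x0; have [c ->] := e_linear v; apply: big1 => j _.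
have := sqr_coord_le j x; rewrite x0 => c0.
have : coord j x ^+ 2 == 0 by rewrite eq_le c0 sqr_ge0.
by rewrite sqrf_eq0 => /eqP ->; rewrite mul0r.
Qed.

(* A null vector [(s, t)] of the symmetric matrix [[a1, g], [g, a2]] is a null
   direction [x + i y] of the complexified quadratic form; then
   [action x + action y = 0], which contradicts coercivity. *)
Lemma coercive_delta_neq0 : 'I_n -> delta a1 a2 g != 0.
Proof.
move=> i0; apply/negP => /eqP; rewrite /delta => d0.
(* The vector [(g, - a1)] is in the kernel once [delta = 0]; it is itself zero only for
   [g = a1 = 0], and then [(1, 0)] serves. *)
have [s [t [st1 st2 st0]]] : exists s t, [/\ a1 * s + g * t = 0, g * s + a2 * t = 0 &
    (s != 0) || (t != 0)].
  have [g0|g0] := eqVneq g 0; last first.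
    exists g, (- a1); split; [ring| |by rewrite g0].
    by rewrite -[RHS]oppr0 -d0; ring.
  have [a10|a10] := eqVneq a1 0.
    by exists 1, 0; split; rewrite ?g0 ?a10 ?oner_eq0//; ring.
  exists g, (- a1); split; [ring| |by rewrite oppr_eq0 a10 orbT].
  by rewrite -[RHS]oppr0 -d0; ring.
(* Pairing [x + i y] with [x - i y] under a symmetric bilinear form cancels the mixed terms; [X] and
   [Y] are the actions at [x] and [y], and [B] is the mixed term. *)
have combine (X Y B : C) :
    (2 * X + 'i * B) - 'i * (B + 'i * (2 * Y)) = 2 * (X + Y).
  by rewrite mulrDr (mulrA 'i 'i) -expr2 sqr_i; ring.
(* Supported at one diagonal entry, so that [polar] reduces to the two kernel equations for
   [(s, t)]. *)
pose u (v : V) : C := if (v.1.2 == i0) && (v.2 == i0) then (if v.1.1 then s else t) else 0.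
have pu p : polar a1 a2 g u p = 0.
  rewrite /polar (@sum2_eq1 _ i0 i0) => [|i j]; last first.
    by rewrite /u/= => /negbTE ->; rewrite !mul0r addr0.
  rewrite /u/= !eqxx/=.
  transitivity (p.1 i0 i0 * (a1 * s + g * t) + p.2 i0 i0 * (g * s + a2 * t)); first ring.
  by rewrite st1 st2 !mulr0 addr0.
have [x [y Hxy]] := e_span u.
have pxy p : polar a1 a2 g (fun v => entry v (e x)) p + 'i * polar a1 a2 g (fun v => entry v (e y)) p = 0.
  by rewrite -polarDi (eq_polar _ Hxy).
have act0 : action a1 a2 g (e x) + action a1 a2 g (e y) = 0.
  have h : 2 * (action a1 a2 g (e x) + action a1 a2 g (e y)) = 0.
    have h1 := pxy (e x); have h2 := pxy (e y).
    rewrite polar_diag in h1; rewrite polar_diag polarC in h2.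
    by rewrite -(combine _ _ (polar a1 a2 g (fun v => entry v (e y)) (e x))) h1 h2 mulr0 subr0.
  by move/eqP: h; rewrite mulf_eq0 pnatr_eq0/= => /eqP.
have [eps eps0 Heps] := e_coercive.
have re0 : Re (action a1 a2 g (e x)) + Re (action a1 a2 g (e y)) = 0 by rewrite -ReD act0.
have sq (z : T) : 0 <= eps * sqnorm2 z by rewrite mulr_ge0 ?sqnorm2_ge0// ltW.
have [rx ry] := ge0_sum_eq0 (sq x) (sq y) (Heps x) (Heps y) re0.
have {}rx : sqnorm2 x = 0 by move/eqP: rx; rewrite mulf_eq0 gt_eqF//= => /eqP.
have {}ry : sqnorm2 y = 0 by move/eqP: ry; rewrite mulf_eq0 gt_eqF//= => /eqP.
have u0 v : u v = 0 by rewrite -Hxy !sqnorm2_eq0_entry// mulr0 addr0.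
have := u0 (true, i0, i0); have := u0 (false, i0, i0).
by rewrite /u/= !eqxx/= => t0 s0; move: st0; rewrite t0 s0 eqxx.
Qed.


(** No ensemble occurs here: both expectations are given by this very polynomial, so no comparison
    of two polynomials is left at the end. *)
Definition entry_sum_moment (s : seq (C * seq V)) : mpoly.mpoly 3 C :=
  \sum_(q <- s) mpoly.mpolyC 3 q.1 * wick R (size q.2) q.2.

Lemma cintegral_entry_sum F (s : seq (C * seq V)) :
  (forall p, F p = \sum_(q <- s) q.1 * word q.2 p) -> delta a1 a2 g != 0 ->
  cintegral mu (fun x => F (e x) * weight_at e a1 a2 g x) =
  eval_ratios (entry_sum_moment s) a1 a2 g * J [::].
Proof.
move=> HF d0.
rewrite (_ : (fun x => _) =
    (fun x => \sum_(q <- s) q.1 * (word q.2 (e x) * weight_at e a1 a2 g x))); last first.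
  by apply/funext => x; rewrite HF mulr_suml; apply: eq_bigr => q _; rewrite mulrA.
have iw w : cintegrable mu (fun x => word w (e x) * weight_at e a1 a2 g x).
  exact: (cintegrable_weighted e_linear (entry_polynomial_word R w) e_coercive).
rewrite cintegral_sum => [|q]; last exact: cintegrableZ.
rewrite /entry_sum_moment eval_ratios_sum mulr_suml; apply: eq_bigr => q _.
rewrite cintegralZ// eval_ratiosM -[cintegral _ _]/(J q.2) (@moment_wick (size q.2))//.
rewrite mulrA; congr (_ * _ * _). exact: esym (mpoly.mevalC _ _).
Qed.

End FixedParameters.
End MomentFormula.

(** * Exponential series, vanishing limits of integrals, and the unit cube *)

Section Auxiliary.
Variable R : realType.
Local Notation C := R[i].
Local Notation Re := (@complex.Re R).
Local Notation Im := (@complex.Im R).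

Lemma cexpD (z w : C) : cexp (z + w) = cexp z * cexp w.
Proof.
apply/eqP; rewrite eq_complex Re_cexp Im_cexp ReD ImD expRD cosD sinD.
rewrite (ReM (cexp z)) (ImM (cexp z)) !Re_cexp !Im_cexp.
by apply/andP; split; apply/eqP; ring.
Qed.

Lemma normc_real (z : R) : `|z%:C| = `|z|%:C.
Proof. by rewrite normc_def/= expr0n addr0 sqrtr_sqr. Qed.

(** The bound is uniform in the truncation order, as dominated convergence for the expanded phase
    requires. *)
Lemma normr_series_le_expR (u : R ^nat) (z : R) k :
  (forall l, `|u l| <= exp_coeff `|z| l) -> `|series u k| <= expR `|z|.
Proof.
move=> Hu; apply: (le_trans (ler_norm_sum _ _ _)).
apply: (@le_trans _ _ (series (exp_coeff `|z|) k)); first exact: ler_sum.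
apply: nondecreasing_cvgn_le; last exact: is_cvg_series_exp_coeff.
apply: nondecreasing_series => l _ _; exact: exp_coeff_ge0.
Qed.

Lemma normr_series_cos_coeff_le (z : R) k : `|series (cos_coeff z) k| <= expR `|z|.
Proof.
apply: normr_series_le_expR => l; rewrite /exp_coeff /cos_coeff /=.
rewrite !normrM normfV !normr_nat !normrX normrN normr1 expr1n mulr1.
by case: odd; rewrite ?mul0r ?mul1r// divr_ge0.
Qed.

Lemma normr_series_sin_coeff_le (z : R) k : `|series (sin_coeff z) k| <= expR `|z|.
Proof.
apply: normr_series_le_expR => l; rewrite /exp_coeff /sin_coeff /=.
rewrite !normrM normfV !normr_nat !normrX normrN normr1 expr1n mulr1.
by case: odd; rewrite ?mul0r ?mul1r// divr_ge0.
Qed.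

Lemma complex_power_sum (a b : nat -> R) (z : R) k :
  \sum_(l < k) (a l +i* b l) * (z%:C) ^+ l =
  (\sum_(0 <= l < k) a l * z ^+ l) +i* (\sum_(0 <= l < k) b l * z ^+ l).
Proof.
elim: k => [|k IHk]; first by rewrite big_ord0 !big_geq.
rewrite big_ord_recr/= IHk !big_nat_recr//= -rmorphXn/=.
by apply/eqP; rewrite eq_complex ReD ImD ReM ImM/= !mulr0 subr0 add0r mulrC eqxx
  [b k * _]mulrC eqxx.
Qed.

Lemma Rintegral_limit_eq0 d (T : measurableType d) (mu : {measure set T -> \bar R})
    (F : nat -> T -> R) (f G : T -> R) :
  (forall k, measurable_fun setT (F k)) -> measurable_fun setT f ->
  (forall x, F k x @[k --> \oo] --> f x) ->
  mu.-integrable setT (EFin \o G) -> (forall k x, `|F k x| <= G x) ->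
  (forall k, \int[mu]_x F k x = 0) -> \int[mu]_x f x = 0.
Proof.
move=> mF mf Ff iG FG F0.
have iF k : mu.-integrable setT (EFin \o F k).
  apply: le_integrable iG => //; first exact/measurable_EFinP.
  by move=> x _; rewrite /= lee_fin (le_trans (FG k x))// ler_norm.
have [||_ _] := @dominated_convergence _ _ _ mu setT measurableT
  (fun k => EFin \o F k) (EFin \o f) (EFin \o G)
  (fun k => (measurable_EFinP _ _).2 (mF k)) ((measurable_EFinP _ _).2 mf) _ iG _.
- by apply: aeW => x _; apply: cvg_EFin (Ff x); exact: nearW.
- by apply: aeW => x k _; rewrite /= lee_fin.
rewrite (_ : (fun k => _) = cst 0%E); last first.
  apply/funext => k; rewrite -[LHS]fineK; last exact: integrable_fin_num (iF k).
  by rewrite -[fine _]/(\int[mu]_x F k x) F0.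
move=> /cvg_lim h; rewrite /Rintegral -h//.
by rewrite lim_cst.
Qed.

Lemma measurable_unit_cube k :
  measurable [set t : k.-tuple (measurableTypeR R) | forall i, `[0, 1]%classic (tnth t i)].
Proof.
rewrite (_ : [set t | _] =
    \bigcap_(i in [set: 'I_k]) ((fun t => tnth t i) @^-1` `[0, 1]%classic)).
  apply: fin_bigcap_measurable => [|i _]; first exact: finite_finset.
  by rewrite -[X in measurable X]setTI; apply: measurable_tnth.
by apply/seteqP; split=> t /= h i => [_|]; exact: h.
Qed.

(** The cube is the test set of two arguments: it shows that Lebesgue measure is not zero, and its
    product with the whole space has infinite measure. *)
Lemma lebesgue_tuple_unit_cube k :
  lebesgue_tuple R k [set t | forall i, `[0, 1]%classic (tnth t i)] = 1%E.
Proof.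
rewrite (lebesgue_tuple_box (A := fun=> `[0, 1]%classic))// big1// => i _.
by rewrite lebesgue_measure_itv/= lte_fin ltr01 sube0.
Qed.

End Auxiliary.

(** * Nonvanishing of the partition function *)

Section Nonvanishing.
Variables (R : realType) (n : nat).
Local Notation C := R[i].
Local Notation Re := (@complex.Re R).
Local Notation Im := (@complex.Im R).
Local Notation M := 'M[C]_n.
Local Notation V := (bool * 'I_n * 'I_n)%type.
Local Notation coords := ((n * n).-tuple (measurableTypeR R)).
Local Notation T := (coords * coords)%type.
Local Notation mu := (lebesgue_coords2 R n).

Lemma action_linear (c a1 a2 g b1 b2 h : C) (p : M * M) :
  action (a1 + c * b1) (a2 + c * b2) (g + c * h) p =
  action a1 a2 g p + c * action b1 b2 h p.
Proof.
rewrite /action; move: (p.1 ^+ 2) (p.2 ^+ 2) (p.1 * p.2) 2^-1 => X Y W t.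
by rewrite !mxtraceD !mxtraceZ; ring.
Qed.

Lemma ReMc (a b : R) (z : C) : Re ((a +i* b) * z) = a * Re z - b * Im z.
Proof. by rewrite ReM. Qed.

Lemma ImMc (a b : R) (z : C) : Im ((a +i* b) * z) = a * Im z + b * Re z.
Proof. by rewrite ImM. Qed.

Definition quadratically_bounded (f : T -> C) : Prop :=
  exists K : R, forall x, `|f x| <= (K * sqnorm2 x)%:C.

Lemma quadratically_boundedD f h : quadratically_bounded f -> quadratically_bounded h ->
  quadratically_bounded (fun x => f x + h x).
Proof.
move=> [K HK] [L HL]; exists (K + L) => x.
by rewrite mulrDl rmorphD (le_trans (ler_normD _ _))// lerD.
Qed.

Lemma quadratically_boundedMl a f : quadratically_bounded f ->
  quadratically_bounded (fun x => a * f x).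
Proof.
move=> [K HK]; exists (Num.sqrt (Re a ^+ 2 + Im a ^+ 2) * K) => x.
by rewrite normrM -mulrA rmorphM/= normc_def ler_wpM2l// ler0c sqrtr_ge0.
Qed.

Lemma quadratically_bounded_sum (K : Type) (r : seq K) (F : K -> T -> C) :
  (forall k, quadratically_bounded (F k)) ->
  quadratically_bounded (fun x => \sum_(k <- r) F k x).
Proof.
move=> HF; elim: r => [|k r [K' IHr]].
  by exists 0 => x; rewrite big_nil normr0 mul0r.
have [L HL] := quadratically_boundedD (HF k) (ex_intro _ K' IHr).
by exists L => x; rewrite big_cons; exact: HL.
Qed.

Lemma quadratically_bounded_coordM j k :
  quadratically_bounded (fun x => (coord j x)%:C * (coord k x)%:C).
Proof.
exists 1 => x; rewrite -rmorphM normc_real lecR mul1r normrM.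
have := sqr_coord_le j x; have := sqr_coord_le k x.
rewrite -!(real_normK (num_real (coord _ x))).
move: (sqnorm2 x) (normr_ge0 (coord j x)) (normr_ge0 (coord k x)).
move: `|coord j x| `|coord k x| => a b s a0 b0; nra.
Qed.

Lemma quadratically_bounded_linearM f h : coord_linear f -> coord_linear h ->
  quadratically_bounded (fun x => f x * h x).
Proof.
move=> [c Hc] [d Hd].
have [K HK] : quadratically_bounded (fun x => \sum_j \sum_k
    (c j * d k) * ((coord j x)%:C * (coord k x)%:C)).
  apply: quadratically_bounded_sum => j; apply: quadratically_bounded_sum => k.
  exact/quadratically_boundedMl/quadratically_bounded_coordM.
exists K => x; apply: le_trans (HK x).
rewrite Hc Hd mulr_suml le_eqVlt; apply/orP; left; apply/eqP; congr `|_|.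
apply: eq_bigr => j _; rewrite mulr_sumr; apply: eq_bigr => k _.
by rewrite mulrACA mulrC.
Qed.

Variable e : T -> M * M.
Hypothesis e_linear : forall v, coord_linear (fun x => entry v (e x)).
Hypothesis e_span : forall u : V -> C, exists x y, forall v,
  entry v (e x) + 'i * entry v (e y) = u v.

Lemma quadratically_bounded_action a1 a2 g :
  quadratically_bounded (fun x => action a1 a2 g (e x)).
Proof.
have [K HK] : quadratically_bounded (fun x => \sum_i \sum_j
   (a1 / 2 * ((e x).1 i j * (e x).1 j i) + a2 / 2 * ((e x).2 i j * (e x).2 j i) +
                 g * ((e x).1 i j * (e x).2 j i))).
  apply: quadratically_bounded_sum => i; apply: quadratically_bounded_sum => j.
  apply: quadratically_boundedD; first apply: quadratically_boundedD;
    apply: quadratically_boundedMl; apply: quadratically_bounded_linearM.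
  - exact: (e_linear (true, i, j)).
  - exact: (e_linear (true, j, i)).
  - exact: (e_linear (false, i, j)).
  - exact: (e_linear (false, j, i)).
  - exact: (e_linear (true, i, j)).
  - exact: (e_linear (false, j, i)).
by exists K => x; rewrite actionE; exact: HK.
Qed.

Variables r1 r2 r0 k1 k2 k0 : C.
Hypothesis action_r_real : forall x, Im (action r1 r2 r0 (e x)) = 0.
Hypothesis action_k_real : forall x, Im (action k1 k2 k0 (e x)) = 0.
Hypothesis r_coercive : coercive e r1 r2 r0.
Hypothesis i0 : 'I_n.

Local Notation p1 s := (r1 + 'i * s%:C * k1).
Local Notation p2 s := (r2 + 'i * s%:C * k2).
Local Notation p0 s := (r0 + 'i * s%:C * k0).
Local Notation phase x := (Re (action k1 k2 k0 (e x))).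
Local Notation wt s := (weight_at e (p1 s) (p2 s) (p0 s)).

Lemma action_phase x : action k1 k2 k0 (e x) = (phase x)%:C.
Proof. by apply/eqP; rewrite eq_complex/= action_k_real !eqxx. Qed.

Lemma Re_action_segment s x :
  Re (action (p1 s) (p2 s) (p0 s) (e x)) = Re (action r1 r2 r0 (e x)).
Proof.
rewrite action_linear action_phase.
by move: (action _ _ _ _) (phase _) => [a b] p /=; ring.
Qed.

(** Moving [s] changes only the imaginary part of the action, so one constant [eps] serves the whole
    segment. *)
Lemma coercive_segment s : coercive e (p1 s) (p2 s) (p0 s).
Proof.
by have [eps eps0 He] := r_coercive; exists eps => // x; rewrite Re_action_segment.
Qed.

Lemma weight_segmentD s h x :
  wt (s + h) x = cexp (0 +i* (- (h * phase x))) * wt s x.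
Proof.
rewrite !weight_atE -cexpD; congr cexp; rewrite !action_linear action_phase.
move: (action _ _ _ _) (phase _) => [a b] p.
by apply/eqP; rewrite eq_complex /=; apply/andP; split; apply/eqP; ring.
Qed.

Lemma normr_weight_segment_le eps s x :
  (forall x, eps * sqnorm2 x <= Re (action r1 r2 r0 (e x))) ->
  `|Re (wt s x)| <= expR (- (eps * sqnorm2 x)) /\
  `|Im (wt s x)| <= expR (- (eps * sqnorm2 x)).
Proof.
move=> Heps; rewrite weight_atE Re_cexp Im_cexp.
have b : expR (Re (- action (p1 s) (p2 s) (p0 s) (e x))) <= expR (- (eps * sqnorm2 x)).
  by rewrite ler_expR raddfN lerN2/= Re_action_segment.
split; rewrite normrM (ger0_norm (expR_ge0 _)); apply: le_trans b.
  by rewrite ler_piMr ?expR_ge0// ler_norml cos_geN1 cos_le1.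
by rewrite ler_piMr ?expR_ge0// ler_norml sin_geN1 sin_le1.
Qed.

Local Notation Z s := (moment e (p1 s) (p2 s) (p0 s) [::]).

Lemma cintegral_entry_polynomial_eq0 s F : Z s = 0 -> entry_polynomial F ->
  cintegral mu (fun x => F (e x) * wt s x) = 0.
Proof.
move=> Z0 [t Ht].
rewrite (cintegral_entry_sum e_linear e_span (coercive_segment s) Ht) ?Z0 ?mulr0//.
exact: (coercive_delta_neq0 e_linear e_span (coercive_segment s) i0).
Qed.

Lemma momentZE s : Z s = cintegral mu (wt s).
Proof.
by congr cintegral; apply/funext => x; rewrite /word big_nil mul1r.
Qed.

(* If the partition function vanishes at [s] then so do all moments; expanding
   [exp (- i h phase)] in powers of [phase], a polynomial in the entries, it then
   vanishes at [s + h] as well, as long as [exp (h phase)] is dominated. *)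
Lemma moment_nil_step eps K s h : 0 < eps ->
  (forall x, eps * sqnorm2 x <= Re (action r1 r2 r0 (e x))) ->
  (forall x, `|phase x| <= K * sqnorm2 x) -> `|h| * K <= eps / 2 ->
  Z s = 0 -> Z (s + h) = 0.
Proof.
move=> eps0 Heps HK hK Z0.
pose y x := - (h * phase x).
(* [cc l +i* sc l] is [i ^ l / l!], so [P k] truncates the series of [exp (i * y)], with partial
   sums of cosine and sine as its parts. It is built from the complex [action k1 k2 k0], not from
   its real part, so that it is a polynomial in the entries. *)
pose cc l : R := (~~ odd l)%:R * (-1) ^+ l./2 * (l`!%:R)^-1.
pose sc l : R := (odd l)%:R * (-1) ^+ l.-1./2 * (l`!%:R)^-1.
pose P k (p : M * M) : C := \sum_(l < k) (cc l +i* sc l) * ((- h%:C) * action k1 k2 k0 p) ^+ l.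
have epP k : entry_polynomial (P k).
  apply: entry_polynomial_sum => l; apply: entry_polynomialM.
    exact: entry_polynomial_cst.
  elim: (l : nat) => [|l' IHl]; first exact: entry_polynomial_cst.
  under eq_fun do rewrite exprS; apply: entry_polynomialM IHl.
  apply: entry_polynomialM; first exact: entry_polynomial_cst.
  exact: entry_polynomial_action.
have PE k x : P k (e x) = series (cos_coeff (y x)) k +i* series (sin_coeff (y x)) k.
  rewrite /P action_phase (_ : - h%:C * (phase x)%:C = (y x)%:C); last first.
    by rewrite /y rmorphN rmorphM mulNr.
  by rewrite complex_power_sum cos_coeffE sin_coeffE.
have dP k := cdecays_weighted e_linear (epP k) (coercive_segment s).
have Pint k : cintegral mu (fun x => P k (e x) * wt s x) = 0.
  exact: cintegral_entry_polynomial_eq0.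
have [[mc _] [ms _]] := cdecays_weight e_linear (coercive_segment (s + h)).
(* By the bound on [|h| * K], half of the decay rate pays for the growth of [exp |y|]; the factor 2
   counts the two real products in the real or imaginary part of a complex product. *)
pose G (x : T) := 2 * expR (- (eps / 2 * sqnorm2 x)).
have iG : mu.-integrable setT (EFin \o G).
  have eps2 : 0 < eps / 2 by rewrite divr_gt0.
  have := integrableZl measurableT 2 (@integrable_gauss2 R (n * n) _ eps2).
  by apply: eq_integrable.
have bound x (a b : R) (u v : R) : `|a| <= expR `|y x| -> `|b| <= expR `|y x| ->
    `|u| <= expR (- (eps * sqnorm2 x)) -> `|v| <= expR (- (eps * sqnorm2 x)) ->
    `|a * u + b * v| <= G x.
  move=> Ha Hb Hu Hv; rewrite (le_trans (ler_normD _ _))// !normrM.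
  have Hy : expR `|y x| * expR (- (eps * sqnorm2 x)) <= expR (- (eps / 2 * sqnorm2 x)).
    rewrite -expRD ler_expR /y normrN normrM.
    have r_ge0 := sqnorm2_ge0 x.
    have h1 := ler_wpM2l (normr_ge0 h) (HK x).
    have h2 := ler_wpM2r r_ge0 hK.
    rewrite mulrA in h1; have {h1 h2} h3 := le_trans h1 h2.
    rewrite [X in - (X * _)]splitr mulrDl opprD addrA.
    by rewrite gerDr subr_le0.
  rewrite /G mulr2n mulrDl !mul1r; apply: lerD; apply: le_trans Hy; exact: ler_pM.
have ptwise x : series (cos_coeff (y x)) k @[k --> \oo] --> cos (y x).
  by rewrite cos.unlock; exact: is_cvg_series_cos_coeff.
have ptwises x : series (sin_coeff (y x)) k @[k --> \oo] --> sin (y x).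
  by rewrite sin.unlock; exact: is_cvg_series_sin_coeff.
have wE x : wt (s + h) x = (cos (y x) +i* sin (y x)) * wt s x.
  by rewrite weight_segmentD; congr (_ * _); rewrite /cexp /= expR0 mul1r.
rewrite momentZE /cintegral.
rewrite (@Rintegral_limit_eq0 _ _ _ mu (fun k x => Re (P k (e x) * wt s x)) _ G) //.
- rewrite (@Rintegral_limit_eq0 _ _ _ mu (fun k x => Im (P k (e x) * wt s x)) _ G) //.
  + by move=> k; exact: (dP k).2.1.
  + move=> x; rewrite wE ImMc; under eq_fun do rewrite PE ImMc.
    by apply: cvgD; apply: cvgMr_tmp.
  + move=> k x; rewrite PE ImMc; apply: bound.
    * exact: normr_series_cos_coeff_le.
    * exact: normr_series_sin_coeff_le.
    * exact: (normr_weight_segment_le _ _ Heps).2.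
    * exact: (normr_weight_segment_le _ _ Heps).1.
  + by move=> k; have [_] := Pint k.
- by move=> k; exact: (dP k).1.1.
- move=> x; rewrite wE ReMc; under eq_fun do rewrite PE ReMc.
  by apply: cvgB; apply: cvgMr_tmp.
- move=> k x; rewrite PE ReMc -mulNr; apply: bound.
  + exact: normr_series_cos_coeff_le.
  + by rewrite normrN; exact: normr_series_sin_coeff_le.
  + exact: (normr_weight_segment_le _ _ Heps).1.
  + exact: (normr_weight_segment_le _ _ Heps).2.
- by move=> k; have [] := Pint k.
Qed.

(** At [s = 0] the weight is real and positive. If its integral were 0 it would vanish almost
    everywhere, so the whole space would be null, contradicting the measure of the unit cube. *)
Lemma moment_nil_real_neq0 : Z 0 != 0.
Proof.
apply/eqP => Z0.
have wE x : Re (wt 0 x) = expR (- Re (action r1 r2 r0 (e x))).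
  rewrite weight_atE Re_cexp !rmorph0 !mulr0 !mul0r !addr0 !raddfN /= action_r_real.
  by rewrite oppr0 cos0 mulr1.
have [dw _] := cdecays_weight e_linear (coercive_segment 0).
have iw := decays_integrable dw; have mw := measurable_int _ iw.
have w0 : (\int[mu]_x `|(Re (wt 0 x))%:E| = 0)%E.
  rewrite (eq_integral (fun x => (Re (wt 0 x))%:E)); last first.
    by move=> x _; rewrite gee0_abs// lee_fin wE expR_ge0.
  rewrite -[LHS]fineK; last exact: integrable_fin_num iw.
  by move: Z0; rewrite momentZE => -[h _]; congr (_%:E); exact: h.
have /(ae_eq_integral_abs _ measurableT mw) [A [mA A0 sA]] := w0.
have AT : A = setT.
  apply/seteqP; split=> // x _; apply: sA => h0; have h : Re (wt 0 x) = 0 by have [] := h0 I.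
  by have := expR_gt0 (- Re (action r1 r2 r0 (e x))); rewrite -wE h ltxx.
pose Q : set coords := [set t | forall i, `[0, 1]%classic (tnth t i)].
have mQ : measurable Q.
  exact: measurable_unit_cube.
have : mu (Q `*` Q) = 1%E.
  have := @product_measure1E _ _ _ _ _ (lebesgue_tuple R (n * n)) (lebesgue_tuple R (n * n))
    _ _ mQ mQ.
  move=> h; apply: (etrans h); rewrite lebesgue_tuple_unit_cube mule1.
  exact: lebesgue_tuple_unit_cube.
have : (mu (Q `*` Q) <= mu A)%E.
  by apply: le_measure; rewrite ?inE//; [exact: measurableX|rewrite AT; exact: subsetT].
by rewrite A0 => Q0 Q1; move: Q0; rewrite Q1 lee_fin ler10.
Qed.

(** The admissible step length depends on [eps] and [K] only, not on the position, so [N] equal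
    steps carry a zero at [s] down to a zero at 0. *)
Lemma moment_nil_neq0 s : Z s != 0.
Proof.
have [eps eps0 Heps] := r_coercive.
have [K0 HK0] := quadratically_bounded_action k1 k2 k0.
have HK x : `|phase x| <= Num.max 1 K0 * sqnorm2 x.
  apply: (@le_trans _ _ (K0 * sqnorm2 x)).
    by rewrite -lecR (le_trans _ (HK0 x))// normc_ge_Re.
  by rewrite ler_wpM2r ?sqnorm2_ge0// le_max lexx orbT.
set K := Num.max 1 K0 in HK.
have Kgt0 : 0 < K by rewrite lt_max ltr01.
pose N := (Num.trunc ((eps / 2)^-1 * (`|s| * K))).+1.
have N0 : (0 : R) < N%:R by rewrite ltr0n.
have hK : `|- s / N%:R| * K <= eps / 2.
  rewrite normrM normrN normfV (ger0_norm (ltW N0)) mulrAC ler_pdivrMr//.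
  by rewrite -ler_pdivrMl ?divr_gt0// ltW// truncnS_gt.
apply/negP => /eqP Zs.
have Zk k : Z (s + k%:R * (- s / N%:R)) = 0.
  elim: k => [|k IHk]; first by rewrite mul0r addr0.
  rewrite -natr1 mulrDl mul1r addrA.
  exact: (moment_nil_step eps0 Heps HK hK IHk).
have sN : s + N%:R * (- s / N%:R) = 0 by rewrite mulrCA divff ?gt_eqF// mulr1 subrr.
have := Zk N; rewrite sN.
by apply/eqP; exact: moment_nil_real_neq0.
Qed.

End Nonvanishing.

(** * Normalised expectations *)

Section Expectation.
Variables (R : realType) (n : nat).
Local Notation C := R[i].
Local Notation Re := (@complex.Re R).
Local Notation Im := (@complex.Im R).
Local Notation M := 'M[C]_n.
Local Notation V := (bool * 'I_n * 'I_n)%type.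
Local Notation coords := ((n * n).-tuple (measurableTypeR R)).
Local Notation T := (coords * coords)%type.
Local Notation mu := (lebesgue_coords2 R n).

Variable e : T -> M * M.
Hypothesis e_linear : forall v, coord_linear (fun x => entry v (e x)).
Hypothesis e_span : forall u : V -> C, exists x y, forall v,
  entry v (e x) + 'i * entry v (e y) = u v.

(** What counts as real depends on the ensemble: real parameters for Hermitian pairs, but a second
    parameter conjugate to the first and a real third one for [(Z, dagger Z)], where conjugation
    exchanges the two traces of squares. *)
Definition real_imaginary_split (a1 a2 g : C) : Prop :=
  exists r1 r2 r0 k1 k2 k0,
  [/\ a1 = r1 + 'i * k1, a2 = r2 + 'i * k2, g = r0 + 'i * k0,
      forall x, Im (action r1 r2 r0 (e x)) = 0 &
      forall x, Im (action k1 k2 k0 (e x)) = 0].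

Variables a1 a2 g : C.
Hypothesis e_split : real_imaginary_split a1 a2 g.
Hypothesis e_coercive : coercive e a1 a2 g.
Hypothesis i0 : 'I_n.

Lemma partition_function_neq0 : moment e a1 a2 g [::] != 0.
Proof.
have [r1 [r2 [r0 [k1 [k2 [k0 [a1E a2E gE rR kR]]]]]]] := e_split.
have i1 : 'i * (1 : R)%:C = 'i :> C by rewrite mulr1.
suff h : coercive e r1 r2 r0.
  have := moment_nil_neq0 e_linear e_span rR kR h i0 1.
  by rewrite i1 -a1E -a2E -gE.
have [eps eps0 He] := e_coercive; exists eps => // x.
apply: le_trans (He x) _; rewrite a1E a2E gE action_linear.
move: (action r1 _ _ _) (action k1 _ _ _) (kR x) => [a b] [c d] /= ->.
by rewrite mul0r mul1r subrr addr0.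
Qed.

Lemma expectation_entry_sum F (s : seq (C * seq V)) :
  (forall p, F p.1 p.2 = \sum_(q <- s) q.1 * word q.2 p) ->
  expectation_defined e F a1 a2 g /\
  gauss_expectation e F a1 a2 g = eval_ratios (entry_sum_moment s) a1 a2 g.
Proof.
move=> HF; have Z0 := partition_function_neq0.
have ZE : moment e a1 a2 g [::] = cintegral mu (weight_at e a1 a2 g).
  by congr cintegral; apply/funext => x; rewrite /word big_nil mul1r.
have epF : entry_polynomial (fun p : M * M => F p.1 p.2) by exists s.
split.
  split; last by rewrite -ZE.
  - exact: (cintegrable_weighted e_linear epF e_coercive).
  - exact: cdecays_cintegrable (cdecays_weight e_linear e_coercive).
rewrite /gauss_expectation.
have d0 := coercive_delta_neq0 e_linear e_span e_coercive i0.
have := cintegral_entry_sum e_linear e_span e_coercive HF d0.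
by rewrite /weighted_at => ->; rewrite -ZE mulfK.
Qed.

End Expectation.

(** * Linear functions of the coordinates, and coordinates as matrices *)

Section CoordLinear.
Variables (R : realType) (n : nat).
Local Notation C := R[i].
Local Notation coords := ((n * n).-tuple (measurableTypeR R)).
Local Notation T := (coords * coords)%type.

Lemma coord_linear_coord j : coord_linear (fun x : T => (coord j x)%:C).
Proof.
exists (fun k => (k == j)%:R) => x; rewrite (bigD1 j)//= eqxx mulr1 big1 ?addr0//.
by move=> k /negbTE ->; rewrite mulr0.
Qed.

Lemma coord_linearD (f h : T -> C) : coord_linear f -> coord_linear h ->
  coord_linear (fun x => f x + h x).
Proof.
move=> [c Hc] [d Hd]; exists (fun j => c j + d j) => x.
by rewrite Hc Hd -big_split/=; apply: eq_bigr => j _; rewrite mulrDr.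
Qed.

Lemma coord_linearMl a (f : T -> C) : coord_linear f -> coord_linear (fun x => a * f x).
Proof.
move=> [c Hc]; exists (fun j => a * c j) => x.
by rewrite Hc mulr_sumr; apply: eq_bigr => j _; rewrite mulrCA.
Qed.

Lemma sqnorm_real_mx (x : coords) : sqnorm x = \sum_i \sum_j real_mx x i j ^+ 2.
Proof.
rewrite /sqnorm pair_bigA/=.
rewrite (reindex (uncurry (@mxvec_index n n)))/=.
  by apply: eq_bigr => -[i j] _; rewrite mxE.
have [h h1 h2] := curry_mxvec_bij n n.
by exists h => y _; [exact: h1|exact: h2].
Qed.

Definition coords_of (X : 'M[R]_n) : coords := [tuple mxvec X 0 k | k < n * n].

Lemma real_mx_coords_of X : real_mx (coords_of X) = X.
Proof. by apply/matrixP => i j; rewrite mxE tnth_mktuple mxvecE. Qed.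

End CoordLinear.

(** * The complex ensemble *)

Section Conjugation.
Variable R : realType.
Implicit Types z w : R[i].

Lemma conjcD z w : conjc (z + w) = conjc z + conjc w.
Proof. exact: rmorphD. Qed.

Lemma conjcM z w : conjc (z * w) = conjc z * conjc w.
Proof. exact: rmorphM. Qed.

Lemma conjcN z : conjc (- z) = - conjc z.
Proof. exact: rmorphN. Qed.

Lemma conjc_half : conjc (2^-1 : R[i]) = 2^-1.
Proof. by rewrite conjc_inv conjc_nat. Qed.

Lemma conjc_i_half : conjc (- 'i / 2 : R[i]) = 'i / 2.
Proof.
by rewrite conjcM conjc_half; congr (_ * _); apply/eqP; rewrite eq_complex/= !oppr0 opprK !eqxx.
Qed.

Lemma mul_i_half : 'i * (- 'i / 2) = 2^-1 :> R[i].
Proof. by rewrite mulrA mulrN -expr2 sqr_i opprK mul1r. Qed.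

Lemma conjc_sum (I : Type) (r : seq I) (F : I -> R[i]) :
  conjc (\sum_(i <- r) F i) = \sum_(i <- r) conjc (F i).
Proof. exact: rmorph_sum. Qed.

Lemma Re_sum (I : Type) (r : seq I) (F : I -> R[i]) :
  complex.Re (\sum_(i <- r) F i) = \sum_(i <- r) complex.Re (F i).
Proof. by elim: r => [|i r IHr]; rewrite ?big_nil// !big_cons ReD IHr. Qed.

Lemma Im_conj_eq0 z : conjc z = z -> complex.Im z = 0.
Proof.
case: z => a b [] /eqP; rewrite -subr_eq0 -opprD oppr_eq0 -mulr2n mulrn_eq0/=.
by move/eqP.
Qed.

(** With [complexified_part2], this solves [Z + i W = z] and [conjc Z + i conjc W = w] for [Z] and
    [W], which exhibits an arbitrary pair of matrices as a complexified point of the ensemble. *)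
Lemma complexified_part1 z w :
  2^-1 * (z + conjc w) + 'i * ((- 'i / 2) * (z - conjc w)) = z.
Proof. by rewrite mulrA mul_i_half -mulrDr; field. Qed.

Lemma complexified_part2 z w :
  conjc (2^-1 * (z + conjc w)) + 'i * conjc ((- 'i / 2) * (z - conjc w)) = w.
Proof.
rewrite (conjcM 2^-1) (conjcM (- 'i / 2)) !conjcD conjcN conjc_half conjc_i_half !conjcK.
rewrite mulrA (_ : 'i * ('i / 2) = - 2^-1); first by field.
by rewrite mulrA -expr2 sqr_i mulN1r.
Qed.

End Conjugation.

Section ComplexEnsemble.
Variables (R : realType) (n : nat).
Local Notation C := R[i].
Local Notation Re := (@complex.Re R).
Local Notation Im := (@complex.Im R).
Local Notation M := 'M[C]_n.
Local Notation V := (bool * 'I_n * 'I_n)%type.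
Local Notation coords := ((n * n).-tuple (measurableTypeR R)).
Local Notation T := (coords * coords)%type.

Lemma complex_pair1E (x : T) i j : (complex_pair x).1 i j =
  (coord (inl (mxvec_index i j)) x)%:C + 'i * (coord (inr (mxvec_index i j)) x)%:C.
Proof.
rewrite /complex_pair /complex_of /= !mxE.
by apply/eqP; rewrite eq_complex/= !mul0r !mul1r !(add0r, addr0, subr0) !eqxx.
Qed.

Lemma complex_pair2E (x : T) i j : (complex_pair x).2 i j = conjc ((complex_pair x).1 j i).
Proof. by rewrite /complex_pair /dagger /= !mxE. Qed.

Lemma complex_pair_linear v : coord_linear (fun x : T => entry v (complex_pair x)).
Proof.
case: v => [[b i] j]; rewrite /entry/=; case: b.
  suff : coord_linear (fun x : T => (complex_pair x).1 i j) by [].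
  have := coord_linearD (coord_linear_coord R (inl (mxvec_index i j)))
    (coord_linearMl 'i (coord_linear_coord R (inr (mxvec_index i j)))).
  by congr coord_linear; apply/funext => x; rewrite complex_pair1E.
have := coord_linearD (coord_linear_coord R (inl (mxvec_index j i)))
  (coord_linearMl (- 'i) (coord_linear_coord R (inr (mxvec_index j i)))).
congr coord_linear; apply/funext => x; rewrite complex_pair2E complex_pair1E.
by apply/eqP; rewrite eq_complex/= !(mul0r, mulr0, mul1r, mulN1r, oppr0, add0r, addr0, subr0) !eqxx.
Qed.

Lemma complex_pair_surj (Z : M) : exists x : T, complex_pair x = (Z, dagger Z).
Proof.
exists (coords_of (map_mx Re Z), coords_of (map_mx Im Z)).
rewrite /complex_pair/= !real_mx_coords_of.
suff -> : complex_of (map_mx Re Z) (map_mx Im Z) = Z by [].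
by apply/matrixP => i j; rewrite !mxE; case: (Z i j).
Qed.

Lemma complex_pair_span (u : V -> C) : exists x y : T, forall v,
  entry v (complex_pair x) + 'i * entry v (complex_pair y) = u v.
Proof.
pose P : M := \matrix_(i, j) u (true, i, j).
pose Q : M := \matrix_(i, j) u (false, i, j).
have [Z ZE] : exists Z : M, forall i j,
    Z i j = 2^-1 * (u (true, i, j) + conjc (u (false, j, i))).
  by exists (2^-1 *: (P + dagger Q)) => i j; rewrite !mxE.
have [W WE] : exists W : M, forall i j,
    W i j = (- 'i / 2) * (u (true, i, j) - conjc (u (false, j, i))).
  by exists ((- 'i / 2) *: (P - dagger Q)) => i j; rewrite !mxE.
have [x xZ] := complex_pair_surj Z; have [y yW] := complex_pair_surj W.
exists x, y => -[[[] i] j]; rewrite xZ yW /entry.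
  by rewrite ZE WE complexified_part1.
by rewrite !mxE ZE WE complexified_part2.
Qed.

Lemma complex_pair_conj_action a1 a2 g (x : T) :
  conjc (action a1 a2 g (complex_pair x)) = action (conjc a2) (conjc a1) (conjc g) (complex_pair x).
Proof.
rewrite !actionE conjc_sum; under eq_bigr do rewrite conjc_sum.
apply: eq_bigr => i _; apply: eq_bigr => j _.
rewrite !complex_pair2E.
move: ((complex_pair x).1 i j) ((complex_pair x).1 j i) => z w.
by rewrite !conjcD !conjcM !conjcK conjc_half; move: 2^-1 => t; ring.
Qed.

Lemma complex_pair_split a1 a2 g : real_imaginary_split (@complex_pair R n) a1 a2 g.
Proof.
pose r1 := 2^-1 * (a1 + conjc a2); pose k1 := (- 'i / 2) * (a1 - conjc a2).
have r1J : conjc r1 = 2^-1 * (a2 + conjc a1).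
  by rewrite /r1 conjcM conjc_half conjcD conjcK addrC.
have k1J : conjc k1 = (- 'i / 2) * (a2 - conjc a1).
  by rewrite /k1 conjcM conjc_i_half conjcD conjcN conjcK
    [in RHS]mulNr [in RHS]mulNr -[in RHS]mulrN opprB addrC.
exists r1, (conjc r1), (Re g)%:C, k1, (conjc k1), (Im g)%:C; split.
- by rewrite /r1 /k1 mulrA mul_i_half -mulrDr; field.
- by rewrite r1J k1J mulrA mul_i_half -mulrDr; field.
- exact: complexE.
- by move=> x; apply: Im_conj_eq0; rewrite complex_pair_conj_action conjcK conjc_real.
- by move=> x; apply: Im_conj_eq0; rewrite complex_pair_conj_action conjcK conjc_real.
Qed.

Lemma sqnorm2_complex_pair (x : T) : sqnorm2 x =
  \sum_i \sum_j (Re ((complex_pair x).1 i j) ^+ 2 + Im ((complex_pair x).1 i j) ^+ 2).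
Proof.
rewrite /sqnorm2 !sqnorm_real_mx -big_split/=; apply: eq_bigr => i _.
by rewrite -big_split/=; apply: eq_bigr => j _; rewrite !mxE.
Qed.

Lemma normr_le_of_sqr_le (t u : R) : 0 <= u -> t ^+ 2 <= u ^+ 2 -> `|t| <= u.
Proof.
by move=> u0 tu; rewrite -[leRHS](ger0_norm u0) -!sqrtr_sqr ler_sqrt ?sqr_ge0.
Qed.

(** The right-hand side is the real part of [(p + i q) (x + i y) (z + i w)]. It is at least minus
    the product of the moduli, and the last two moduli are handled by the arithmetic-geometric mean
    inequality. *)
Lemma cauchy_product_bound (p q c x y z w : R) :
  p ^+ 2 + q ^+ 2 <= c ^+ 2 -> 0 <= c ->
  - (c * ((x ^+ 2 + y ^+ 2 + (z ^+ 2 + w ^+ 2)) / 2)) <=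
  p * (x * z - y * w) - q * (x * w + y * z).
Proof.
move=> pqc c0; set m := (_ / 2); set t := (leRHS).
have m0 : 0 <= m by rewrite /m divr_ge0// !addr_ge0 ?sqr_ge0.
have h1 : t ^+ 2 <= (p ^+ 2 + q ^+ 2) * ((x ^+ 2 + y ^+ 2) * (z ^+ 2 + w ^+ 2)).
  rewrite -subr_ge0 (_ : _ - _ =
    (p * (x * w + y * z) + q * (x * z - y * w)) ^+ 2) ?sqr_ge0// /t; ring.
have h2 : (x ^+ 2 + y ^+ 2) * (z ^+ 2 + w ^+ 2) <= m ^+ 2.
  rewrite -subr_ge0 (_ : _ - _ = ((x ^+ 2 + y ^+ 2 - (z ^+ 2 + w ^+ 2)) / 2) ^+ 2) ?sqr_ge0//.
  by rewrite /m; field.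
have h3 : t ^+ 2 <= (c * m) ^+ 2.
  rewrite exprMn; apply: (le_trans h1); apply: ler_pM => //.
    by rewrite addr_ge0 ?sqr_ge0.
  by rewrite mulr_ge0// addr_ge0 ?sqr_ge0.
have : `|t| <= c * m.
  by apply: normr_le_of_sqr_le => //; rewrite mulr_ge0.
by rewrite ler_norml => /andP[].
Qed.

Lemma Re_half (z : C) : Re (z / 2) = Re z / 2.
Proof.
have -> : 2^-1 = (2^-1 : R)%:C :> C by rewrite fmorphV rmorph_nat.
by rewrite ReM /= mulr0 subr0.
Qed.

(** A number and its conjugate have the same real part, so [a1] and [a2] enter only through
    [a1 + conjc a2]. *)
Lemma Re_complex_action_term (a1 a2 g z w : C) :
  Re (a1 / 2 * (z * w) + a2 / 2 * (conjc w * conjc z) + g * (z * conjc z)) =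
  (Re (a1 + conjc a2) * Re (z * w) - Im (a1 + conjc a2) * Im (z * w)) / 2 +
  Re g * (Re z ^+ 2 + Im z ^+ 2).
Proof.
rewrite (mulrAC a1) (mulrAC a2) !ReD !Re_half.
by case: a1 a2 g z w => [x1 y1] [x2 y2] [x3 y3] [x4 y4] [x5 y5] /=; field.
Qed.

Lemma complex_pair_coercive a1 a2 g (c : R) :
  Re (a1 + conjc a2) ^+ 2 + Im (a1 + conjc a2) ^+ 2 <= c ^+ 2 -> 0 <= c ->
  c < 2 * Re g -> coercive (@complex_pair R n) a1 a2 g.
Proof.
move=> hc c0 cg; pose eps := Re g - c / 2.
exists eps; first by rewrite /eps subr_gt0 ltr_pdivrMr// mulrC.
move=> x; rewrite sqnorm2_complex_pair actionE.
set Z := (complex_pair x).1.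
pose N i j : R := Re (Z i j) ^+ 2 + Im (Z i j) ^+ 2.
have termE i j : Re (a1 / 2 * (Z i j * Z j i) + a2 / 2 * ((complex_pair x).2 i j *
    (complex_pair x).2 j i) + g * (Z i j * (complex_pair x).2 j i)) =
  (Re (a1 + conjc a2) * Re (Z i j * Z j i) - Im (a1 + conjc a2) * Im (Z i j * Z j i)) / 2 +
  Re g * N i j.
  by rewrite !complex_pair2E Re_complex_action_term.
rewrite Re_sum.
have -> : \sum_i Re (\sum_j (a1 / 2 * (Z i j * Z j i) + a2 / 2 *
    ((complex_pair x).2 i j * (complex_pair x).2 j i) +
    g * (Z i j * (complex_pair x).2 j i))) =
  \sum_i \sum_j ((Re (a1 + conjc a2) * Re (Z i j * Z j i) -
    Im (a1 + conjc a2) * Im (Z i j * Z j i)) / 2 + Re g * N i j).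
  by apply: eq_bigr => i _; rewrite Re_sum; apply: eq_bigr => j _; rewrite termE.
(* The bound on the [(i, j)] term involves the moduli at both [(i, j)] and [(j, i)]; after summation
   the two contribute equally. *)
have NT : \sum_i \sum_j N j i = \sum_i \sum_j N i j by rewrite exchange_big.
rewrite -[leLHS]/(eps * \sum_i \sum_j N i j).
have -> : eps * \sum_i \sum_j N i j =
    \sum_i \sum_j (- (c * ((N i j + N j i) / 2)) / 2 + Re g * N i j).
  transitivity (- (c / 4) * (\sum_i \sum_j N i j + \sum_i \sum_j N j i) +
    Re g * \sum_i \sum_j N i j).
    by rewrite NT /eps; field.
  rewrite -big_split/= !mulr_sumr -big_split/=; apply: eq_bigr => i _.
  by rewrite -big_split/= !mulr_sumr -big_split/=; apply: eq_bigr => j _; field.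
apply: ler_sum => i _; apply: ler_sum => j _; rewrite lerD2r ler_pM2r//.
by rewrite ReM ImM; exact: cauchy_product_bound.
Qed.

(** The left-hand side is the real part of [(p + i q) exp (i t)]; this [t] rotates [p + i q] onto
    the negative real axis. *)
Lemma exists_phase_opposite (p q : R) :
  exists t, p * cos t - q * sin t = - Num.sqrt (p ^+ 2 + q ^+ 2).
Proof.
set r := Num.sqrt _.
have s0 : 0 <= p ^+ 2 + q ^+ 2 by rewrite addr_ge0 ?sqr_ge0.
have rr : r ^+ 2 = p ^+ 2 + q ^+ 2 by rewrite sqr_sqrtr.
have [r0|r0] := eqVneq r 0.
  have /eqP : p ^+ 2 + q ^+ 2 = 0 by rewrite -rr r0 expr0n.
  rewrite paddr_eq0 ?sqr_ge0// !sqrf_eq0 => /andP[/eqP -> /eqP ->].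
  by exists 0; rewrite !mul0r subrr r0 oppr0.
have rgt0 : 0 < r by rewrite lt_neqAle eq_sym r0 sqrtr_ge0.
have pr : -1 <= - p / r <= 1.
  rewrite -ler_norml normrM normrN normfV (ger0_norm (ltW rgt0)) ler_pdivrMr// mul1r.
  by apply: normr_le_of_sqr_le; [exact: ltW|rewrite rr lerDl sqr_ge0].
have sE : sin (acos (- p / r)) = `|q| / r.
  rewrite sin_acos// (_ : 1 - _ = (q / r) ^+ 2).
    by rewrite sqrtr_sqr normrM normfV (ger0_norm (ltW rgt0)).
  by rewrite !exprMn exprVn rr sqrrN; field; rewrite -rr sqrf_eq0.
have cE : cos (acos (- p / r)) = - p / r by rewrite acosK// in_itv.
have fin : - (p ^+ 2 + q ^+ 2) / r = - r by rewrite -rr; field.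
(* The sine of an arc cosine is nonnegative, so the sign of [q] decides the sign of the angle. *)
have [q0|q0] := lerP 0 q.
  exists (acos (- p / r)); rewrite cE sE (ger0_norm q0) -fin; field; exact: r0.
exists (- acos (- p / r)); rewrite cosN sinN cE sE (ltr0_norm q0) -fin; field; exact: r0.
Qed.

(** The least favourable [theta] turns the pointwise condition into [|a1 + conjc a2| < 2 * Re g]. *)
Lemma domain_C_coercive a1 a2 g : domain_C a1 a2 g -> coercive (@complex_pair R n) a1 a2 g.
Proof.
move=> dC; set p := Re (a1 + conjc a2); set q := Im (a1 + conjc a2).
apply: (@complex_pair_coercive _ _ _ (Num.sqrt (p ^+ 2 + q ^+ 2))).
- by rewrite sqr_sqrtr// addr_ge0 ?sqr_ge0.
- exact: sqrtr_ge0.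
have [t ht] := exists_phase_opposite p q.
rewrite -subr_gt0 -ht.
have := dC t; congr (0 < _); rewrite !ReD !ReM /cexp /= !expR0 cosN sinN.
rewrite /p /q; case: (a1) (a2) (g) => [x1 y1] [x2 y2] [x3 y3] /=; ring.
Qed.

End ComplexEnsemble.

(** * The Hermitian ensemble *)

Section HermitianEnsemble.
Variables (R : realType) (n : nat).
Local Notation C := R[i].
Local Notation Re := (@complex.Re R).
Local Notation Im := (@complex.Im R).
Local Notation M := 'M[C]_n.
Local Notation V := (bool * 'I_n * 'I_n)%type.
Local Notation coords := ((n * n).-tuple (measurableTypeR R)).
Local Notation T := (coords * coords)%type.

Definition block b (x : T) : 'M[R]_n := real_mx (if b then x.1 else x.2).

Lemma herm_entryE b i j (x : T) :
  entry (b, i, j) (herm_pair x) = hermitian_of (block b x) i j.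
Proof. by rewrite /entry /herm_pair /block; case: b. Qed.

Lemma block_coord_linear b i j : coord_linear (fun x : T => (block b x i j)%:C).
Proof.
have := coord_linear_coord R ((if b then inl else inr) (mxvec_index i j)).
by congr coord_linear; apply/funext => x; rewrite /block mxE; case: b.
Qed.

Lemma hermitian_of_lt (X : 'M[R]_n) (i j : 'I_n) : (i < j)%N ->
  hermitian_of X i j = X i j +i* X j i.
Proof. by move=> ij; rewrite mxE ij; case: eqVneq ij => // ->; rewrite ltnn. Qed.

Lemma hermitian_of_gt (X : 'M[R]_n) (i j : 'I_n) : (j < i)%N ->
  hermitian_of X i j = X j i -i* X i j.
Proof.
move=> ji; rewrite mxE ltnNge (ltnW ji)/=; case: eqVneq ji => // ->.
by rewrite ltnn.
Qed.

Lemma herm_pair_linear v : coord_linear (fun x : T => entry v (herm_pair x)).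
Proof.
case: v => [[b i] j].
suff : coord_linear (fun x : T => hermitian_of (block b x) i j).
  by congr coord_linear; apply/funext => x; rewrite herm_entryE.
have L := block_coord_linear b.
case: (ltngtP i j) => ij.
- have := coord_linearD (L i j) (coord_linearMl 'i%C (L j i)).
  congr coord_linear; apply/funext => x; rewrite hermitian_of_lt//.
  by apply/eqP; rewrite eq_complex/= !mul0r !mul1r !(add0r, addr0, subr0) !eqxx.
- have := coord_linearD (L j i) (coord_linearMl (- 'i%C) (L i j)).
  congr coord_linear; apply/funext => x; rewrite hermitian_of_gt//.
  by apply/eqP; rewrite eq_complex/= !(oppr0, mulN1r, mul0r, mulr0, add0r, addr0, subr0) !eqxx.
- have := L i i; congr coord_linear; apply/funext => x.
  by rewrite [RHS]mxE (val_inj ij) eqxx.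
Qed.

Lemma conjc_hermitian_of (X : 'M[R]_n) i j :
  conjc (hermitian_of X i j) = hermitian_of X j i.
Proof.
rewrite !mxE [j == i]eq_sym; case: eqVneq => [->|ij]; first exact: conjc_real.
by case: (ltngtP i j) => // [_|/val_inj/eqP]; [rewrite /= opprK|rewrite (negbTE ij)].
Qed.

Lemma hermitian_of_surj (H : M) : (forall i j, conjc (H i j) = H j i) ->
  exists X, hermitian_of X = H.
Proof.
move=> HH; exists (\matrix_(i, j) if (i <= j)%N then Re (H i j) else Im (H j i)).
apply/matrixP => i j; rewrite !mxE leqnn.
case: eqVneq => [<-|ij].
  by have := Im_conj_eq0 (HH i i); case: (H i i) => a b /= ->.
case: (ltngtP i j) => [lij|lij|/val_inj/eqP]; last by rewrite (negbTE ij).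
  by case: (H i j).
by rewrite -(HH j i); case: (H j i).
Qed.

Lemma herm_pair_surj (A B : M) : (forall i j, conjc (A i j) = A j i) ->
  (forall i j, conjc (B i j) = B j i) -> exists x : T, herm_pair x = (A, B).
Proof.
move=> /hermitian_of_surj[X <-] /hermitian_of_surj[Y <-].
by exists (coords_of X, coords_of Y); rewrite /herm_pair/= !real_mx_coords_of.
Qed.

Lemma herm_pair_span (u : V -> C) : exists x y : T, forall v,
  entry v (herm_pair x) + 'i * entry v (herm_pair y) = u v.
Proof.
have [P PE] : exists P : bool -> M, forall b i j,
    P b i j = 2^-1 * (u (b, i, j) + conjc (u (b, j, i))).
  by exists (fun b => \matrix_(i, j) (2^-1 * (u (b, i, j) + conjc (u (b, j, i))))) => b i j;
    rewrite mxE.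
have [Q QE] : exists Q : bool -> M, forall b i j,
    Q b i j = (- 'i / 2) * (u (b, i, j) - conjc (u (b, j, i))).
  by exists (fun b => \matrix_(i, j) ((- 'i / 2) * (u (b, i, j) - conjc (u (b, j, i))))) => b i j;
    rewrite mxE.
have PH b i j : conjc (P b i j) = P b j i.
  by rewrite !PE (conjcM 2^-1) conjc_half conjcD conjcK addrC.
have QH b i j : conjc (Q b i j) = Q b j i.
  rewrite !QE (conjcM (- 'i / 2)) conjc_i_half conjcD conjcN conjcK.
  by rewrite [in RHS]mulNr [in RHS]mulNr -[in RHS]mulrN opprB addrC.
have [x Hx] := herm_pair_surj (PH true) (PH false).
have [y Hy] := herm_pair_surj (QH true) (QH false).
exists x, y => -[[b i] j]; rewrite Hx Hy /entry.
by case: b; rewrite PE QE complexified_part1.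
Qed.

Lemma herm_pair1_conj (x : T) i j : (herm_pair x).1 j i = conjc ((herm_pair x).1 i j).
Proof. by rewrite conjc_hermitian_of. Qed.

Lemma herm_pair2_conj (x : T) i j : (herm_pair x).2 j i = conjc ((herm_pair x).2 i j).
Proof. by rewrite conjc_hermitian_of. Qed.

Lemma herm_pair_conj_action a1 a2 g (x : T) :
  conjc (action a1 a2 g (herm_pair x)) = action (conjc a1) (conjc a2) (conjc g) (herm_pair x).
Proof.
rewrite !actionE conjc_sum; under eq_bigr do rewrite conjc_sum.
rewrite exchange_big/=; apply: eq_bigr => i _; apply: eq_bigr => j _.
rewrite (herm_pair1_conj x i j) (herm_pair2_conj x i j).
move: ((herm_pair x).1 i j) ((herm_pair x).2 i j) => z w.
by rewrite !conjcD !conjcM !conjcK conjc_half; move: 2^-1 => t; ring.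
Qed.

Lemma herm_pair_real_action (a b c : R) (x : T) :
  Im (action a%:C b%:C c%:C (herm_pair x)) = 0.
Proof. by apply: Im_conj_eq0; rewrite herm_pair_conj_action !conjc_real. Qed.

Lemma herm_pair_split a1 a2 g : real_imaginary_split (@herm_pair R n) a1 a2 g.
Proof.
exists (Re a1)%:C, (Re a2)%:C, (Re g)%:C, (Im a1)%:C, (Im a2)%:C, (Im g)%:C.
by split; try exact: complexE; move=> x; exact: herm_pair_real_action.
Qed.

Definition herm_term (a b c : R) (x : T) i j : R :=
  let z := (herm_pair x).1 i j in let w := (herm_pair x).2 i j in
  a / 2 * (Re z ^+ 2 + Im z ^+ 2) + b / 2 * (Re w ^+ 2 + Im w ^+ 2) +
  c * (Re z * Re w + Im z * Im w).

Lemma Re_herm_action a1 a2 g (x : T) : Re (action a1 a2 g (herm_pair x)) =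
  \sum_i \sum_j herm_term (Re a1) (Re a2) (Re g) x i j.
Proof.
have -> : Re (action a1 a2 g (herm_pair x)) =
    Re (action (Re a1)%:C (Re a2)%:C (Re g)%:C (herm_pair x)).
  rewrite {1}(complexE a1) {1}(complexE a2) {1}(complexE g) action_linear.
  have := herm_pair_real_action (Im a1) (Im a2) (Im g) x.
  move: (action _ _ _ _) (action _ _ _ _) => [p q] [s t] /= ->.
  by rewrite mul0r mul1r subrr addr0.
rewrite actionE Re_sum; apply: eq_bigr => i _; rewrite Re_sum; apply: eq_bigr => j _.
rewrite /herm_term (herm_pair1_conj x i j) (herm_pair2_conj x i j).
move: ((herm_pair x).1 i j) ((herm_pair x).2 i j) => z w.
rewrite (mulrAC (Re a1)%:C) (mulrAC (Re a2)%:C) !ReD !Re_half.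
by move: (Re a1) (Re a2) (Re g) => a b c; case: z w => [x1 y1] [x2 y2] /=; field.
Qed.

(** The constant is half of determinant over trace of [[[a, c], [c, b]]], hence at most half of the
    smaller eigenvalue, because the larger one is at most the trace. The proof completes the square
    after subtracting it. *)
Lemma quadratic_form_lower (a b c u v : R) : 0 < a -> 0 < b -> c ^+ 2 < a * b ->
  (a * b - c ^+ 2) / (2 * (a + b)) * (u ^+ 2 + v ^+ 2) <=
  a / 2 * u ^+ 2 + b / 2 * v ^+ 2 + c * (u * v).
Proof.
move=> a0 b0 cab; have ab0 : 0 < a + b by rewrite addr_gt0.
set eps := (a * b - c ^+ 2) / (2 * (a + b)).
have a'E : a - 2 * eps = (a ^+ 2 + c ^+ 2) / (a + b).
  by rewrite /eps; field; rewrite gt_eqF.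
have a'0 : 0 < a - 2 * eps by rewrite a'E divr_gt0// ltr_wpDr ?sqr_ge0// exprn_gt0.
have det : c ^+ 2 <= (a - 2 * eps) * (b - 2 * eps).
  have -> : (a - 2 * eps) * (b - 2 * eps) = c ^+ 2 + 4 * eps ^+ 2.
    by rewrite /eps; field; rewrite gt_eqF.
  by rewrite lerDl mulr_ge0 ?sqr_ge0.
have a'20 : 0 < 2 * (a - 2 * eps) by rewrite mulr_gt0.
have key : 2 * (a - 2 * eps) *
    (a / 2 * u ^+ 2 + b / 2 * v ^+ 2 + c * (u * v) - eps * (u ^+ 2 + v ^+ 2)) =
  ((a - 2 * eps) * u + c * v) ^+ 2 + ((a - 2 * eps) * (b - 2 * eps) - c ^+ 2) * v ^+ 2.
  by move: (eps) => t; field.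
rewrite -subr_ge0 -(pmulr_rge0 _ a'20) key.
by rewrite addr_ge0 ?sqr_ge0// mulr_ge0 ?sqr_ge0// subr_ge0.
Qed.

(** The coordinate stored at [(i, j)] is, up to sign, the real or the imaginary part of the entry
    [(i, j)]; this compares the coordinate norm with the moduli of the entries. *)
Lemma sqr_block_le b (x : T) i j : block b x i j ^+ 2 <=
  Re (entry (b, i, j) (herm_pair x)) ^+ 2 + Im (entry (b, i, j) (herm_pair x)) ^+ 2.
Proof.
rewrite herm_entryE [hermitian_of _ _ _]mxE; move: (block b x) => X.
case: (eqVneq i j) => [->|_] /=; first by rewrite lerDl sqr_ge0.
by case: ifP => _ /=; rewrite ?sqrrN ?lerDl ?lerDr sqr_ge0.
Qed.

Lemma herm_pair_coercive a1 a2 g : 0 < Re a1 -> 0 < Re a2 ->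
  Re g ^+ 2 < Re a1 * Re a2 -> coercive (@herm_pair R n) a1 a2 g.
Proof.
move=> a0 b0 cab.
pose eps := (Re a1 * Re a2 - Re g ^+ 2) / (2 * (Re a1 + Re a2)).
have eps0 : 0 < eps by rewrite divr_gt0 ?subr_gt0// mulr_gt0// addr_gt0.
exists eps => // x; rewrite Re_herm_action /sqnorm2 !sqnorm_real_mx -big_split/=.
rewrite mulr_sumr; apply: ler_sum => i _; rewrite -big_split mulr_sumr/=.
apply: ler_sum => j _; rewrite /herm_term.
have := sqr_block_le true x i j; have := sqr_block_le false x i j.
rewrite /entry /block/=.
move: ((herm_pair x).1 i j) ((herm_pair x).2 i j) => [p q] [s t] /= hB hA.
apply: (@le_trans _ _ (eps * ((p ^+ 2 + q ^+ 2) + (s ^+ 2 + t ^+ 2)))).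
  by rewrite ler_pM2l// lerD.
have := quadratic_form_lower p s a0 b0 cab; have := quadratic_form_lower q t a0 b0 cab.
rewrite -/eps => h1 h2.
rewrite (_ : eps * _ = eps * (p ^+ 2 + s ^+ 2) + eps * (q ^+ 2 + t ^+ 2)); last by ring.
apply: (le_trans (lerD h2 h1)); rewrite le_eqVlt; apply/orP; left; apply/eqP; ring.
Qed.

Lemma lebesgue_tuple_setT k : lebesgue_tuple R k.+1 setT = +oo%E.
Proof.
have lT : @lebesgue_measure R setT = +oo%E by rewrite -set_itvNyy lebesgue_measure_itv.
have := lebesgue_tuple_box (k := k.+1) (A := fun=> (setT : set (measurableTypeR R)))
  (fun=> measurableT).
rewrite (_ : [set t | _] = setT); last by apply/seteqP.
move=> ->; elim: k => [|k IHk]; first by rewrite big_ord_recr big_ord0/= mul1e.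
by rewrite big_ord_recr/= IHk lT mulyy.
Qed.

Lemma not_integrable_of_lower_bound d (X : measurableType d)
    (mu : {measure set X -> \bar R}) (f : X -> R) (E : set X) (eps : R) :
  measurable E -> mu E = +oo%E -> 0 < eps -> (forall x, E x -> eps <= `|f x|) ->
  ~ mu.-integrable setT (EFin \o f).
Proof.
move=> mE muE eps0 Hf /integrableP[mf].
apply/negP; rewrite -leNgt.
apply: (@le_trans _ _ (\int[mu]_(x in E) `|(f x)%:E|)%E); last first.
  by apply: ge0_subset_integral => //; exact: measurableT_comp.
apply: (@le_trans _ _ (\int[mu]_(x in E) (cst eps%:E x))%E).
  by rewrite integral_cst// muE gt0_muley ?lte_fin.
apply: ge0_le_integral => //.
- by move=> x _; rewrite lee_fin ltW.
- by apply: measurable_funTS; exact: measurableT_comp.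
Qed.

End HermitianEnsemble.

(** * Coercivity on the Hermitian domain *)

Section DomainH.
Variables (R : realType) (n : nat).
Hypothesis n_gt0 : (0 < n)%N.
Local Notation C := R[i].
Local Notation Re := (@complex.Re R).
Local Notation Im := (@complex.Im R).
Local Notation coords := ((n * n).-tuple (measurableTypeR R)).
Local Notation T := (coords * coords)%type.
Local Notation mu := (lebesgue_coords2 R n).

Lemma leading_coef_ge0 (a b : R) : (forall y, 0 < y -> 0 < a * y ^+ 2 + b) -> 0 <= a.
Proof.
move=> H; rewrite leNgt; apply/negP => a0.
(* For [a < 0] the value at [y = 1 + t] is at most [a - 2 * |b| + b], which is negative. *)
pose t := `|b| / (- a).
have t0 : 0 <= t by rewrite divr_ge0// oppr_ge0 ltW.
have at1 : a * t = - `|b| by rewrite /t; field; rewrite lt_eqF.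
have at2 : a * t ^+ 2 <= 0 by rewrite mulr_le0_ge0 ?sqr_ge0// ltW.
have := H (1 + t); rewrite ltr_wpDr// => /(_ isT).
have -> : a * (1 + t) ^+ 2 + b = a + 2 * (a * t) + a * t ^+ 2 + b by ring.
rewrite at1; have := ler_norm b; have := normr_ge0 b.
move: `|b| (a * t ^+ 2) at2 => p q; lra.
Qed.

(** This is the pointwise condition of [domain_H] at [y = expR phi], multiplied by [y]. The last two
    cases are the degenerate parameters. *)
Lemma positive_quadratic_cases (a b c : R) :
  (forall y, 0 < y -> 0 < a * y ^+ 2 + b + 2 * c * y /\ 0 < a * y ^+ 2 + b - 2 * c * y) ->
  [\/ [/\ 0 < a, 0 < b & c ^+ 2 < a * b], [/\ a = 0, c = 0 & 0 < b] |
      [/\ b = 0, c = 0 & 0 < a]].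
Proof.
move=> H.
have Hk y : 0 < y -> 0 < a * y ^+ 2 + b - 2 * `|c| * y.
  by move=> y0; have [h1 h2] := H y y0; case: (lerP 0 c) => c0;
    [rewrite ger0_norm|rewrite ltr0_norm// mulrN mulNr opprK].
have H0 y : 0 < y -> 0 < a * y ^+ 2 + b.
  by move=> y0; have [h1 h2] := H y y0; lra.
have a0 := leading_coef_ge0 H0.
have b0 : 0 <= b.
  apply: (@leading_coef_ge0 b a) => y y0.
  have yV : 0 < y^-1 by rewrite invr_gt0.
  have := H0 _ yV; rewrite -(pmulr_rgt0 _ (exprn_gt0 2 y0)).
  congr (0 < _); field; exact: lt0r_neq0.
have k0 := normr_ge0 c.
have [a_eq0|a_neq0] := eqVneq a 0.
  have c_eq0 : c = 0.
    apply/eqP/negPn/negP => c_neq0; have kgt0 : 0 < `|c| by rewrite normr_gt0.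
    (* At this point the affine function [b - 2 * |c| * y] equals -1. *)
    have y0 : 0 < (b + 1) / (2 * `|c|) by rewrite divr_gt0 ?mulr_gt0// ltr_wpDl.
    have := Hk _ y0.
    rewrite a_eq0 mul0r add0r [X in b - X]mulrC divfK ?gt_eqF ?mulr_gt0//.
    by move=> ?; lra.
  by apply: Or32; split=> //; have := H0 1 ltr01; rewrite a_eq0 mul0r add0r.
have agt0 : 0 < a by rewrite lt_neqAle eq_sym a_neq0.
have [b_eq0|b_neq0] := eqVneq b 0.
  apply: Or33; split=> //; apply/eqP/negPn/negP => c_neq0.
  have kgt0 : 0 < `|c| by rewrite normr_gt0.
  have := Hk (`|c| / a); rewrite divr_gt0// => /(_ isT).
  rewrite b_eq0 addr0 (_ : _ - _ = - (`|c| ^+ 2 / a)); last by field.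
  by rewrite oppr_gt0 ltNge divr_ge0// sqr_ge0.
have bgt0 : 0 < b by rewrite lt_neqAle eq_sym b_neq0.
apply: Or31; split=> //; have [->|c_neq0] := eqVneq c 0.
  by rewrite expr0n mulr_gt0.
have kgt0 : 0 < `|c| by rewrite normr_gt0.
(* The vertex of the parabola, where its value is [b - c ^ 2 / a]. *)
have := Hk (`|c| / a); rewrite divr_gt0// => /(_ isT).
have kE : a * (a * (`|c| / a) ^+ 2 + b - 2 * `|c| * (`|c| / a)) = a * b - `|c| ^+ 2.
  by field.
rewrite -(pmulr_rgt0 _ agt0) kE.
by rewrite real_normK ?num_real// subr_gt0.
Qed.

(** The modulus of the weight is at least [expR (- K)] on [E], and the sum of the absolute values of
    its real and imaginary parts dominates the modulus. *)
Lemma weight_not_cintegrable a1 a2 g (E : set T) (K : R) :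
  measurable E -> mu E = +oo%E ->
  (forall x, E x -> Re (action a1 a2 g (herm_pair x)) <= K) ->
  ~ cintegrable mu (weight_at (@herm_pair R n) a1 a2 g).
Proof.
move=> mE muE HK [iR iI].
have iS := integrableD measurableT (integrable_abse iR) (integrable_abse iI).
apply: (@not_integrable_of_lower_bound R _ _ mu
  (fun x => `|Re (weight_at (@herm_pair R n) a1 a2 g x)| +
            `|Im (weight_at (@herm_pair R n) a1 a2 g x)|) E (expR (- K)) mE muE) => //.
- exact: expR_gt0.
- move=> x Ex; rewrite ger0_norm ?addr_ge0// weight_atE Re_cexp Im_cexp.
  set w := - action _ _ _ _.
  apply: (@le_trans _ _ (expR (Re w))); first by rewrite ler_expR raddfN lerN2 HK.
  rewrite !normrM (ger0_norm (expR_ge0 _)) -mulrDr ler_peMr ?expR_ge0//.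
  have := cos2Dsin2 (Im w); rewrite -(real_normK (num_real (cos _))) -(real_normK (num_real (sin _))).
  have c1 : `|cos (Im w)| <= 1 by rewrite ler_norml cos_geN1 cos_le1.
  have s1 : `|sin (Im w)| <= 1 by rewrite ler_norml sin_geN1 sin_le1.
  move: (normr_ge0 (cos (Im w))) (normr_ge0 (sin (Im w))) c1 s1.
  by move: `|cos _| `|sin _| => p q; nra.
Qed.

Local Notation cube := [set t : coords | forall i, `[0, 1]%classic (tnth t i)].

Lemma hermitian_of_cube_le (t : coords) i j : cube t ->
  Re (hermitian_of (real_mx t) i j) ^+ 2 + Im (hermitian_of (real_mx t) i j) ^+ 2 <= 2.
Proof.
move=> Qt; have X01 k l : real_mx t k l ^+ 2 <= 1.
  rewrite mxE; have := Qt (mxvec_index k l); rewrite /= in_itv/= => /andP[x0 x1].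
  by rewrite expr_le1.
rewrite [hermitian_of _ _ _]mxE; move: (real_mx t) X01 => X X01.
case: (eqVneq i j) => [->|_] /=.
  by rewrite expr0n addr0 (le_trans (X01 j j))// ler1n.
by case: ifP => _ /=; rewrite ?sqrrN -[leRHS]/(1 + 1) lerD.
Qed.

Lemma herm_block_sum_le (t : coords) (b : R) : cube t -> 0 <= b ->
  \sum_i \sum_j b / 2 * (Re (hermitian_of (real_mx t) i j) ^+ 2 +
    Im (hermitian_of (real_mx t) i j) ^+ 2) <= \sum_(i < n) \sum_(j < n) b.
Proof.
move=> Qt b0; apply: ler_sum => i _; apply: ler_sum => j _.
rewrite -mulrA ler_piMr// ler_pdivrMl// mulr1; exact: hermitian_of_cube_le.
Qed.

(** In a degenerate case the real part of the action involves only one matrix. It stays bounded when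
    that matrix lies in the cube and the other is free, on a set of infinite measure, against
    absolute convergence. *)
Lemma domain_H_coercive a1 a2 g : domain_H n a1 a2 g -> coercive (@herm_pair R n) a1 a2 g.
Proof.
move=> [Hpos iw].
have nn0 : (0 < n * n)%N by rewrite muln_gt0 n_gt0.
have muT : lebesgue_tuple R (n * n) setT = +oo%E.
  by case: (n * n)%N nn0 => // k _; exact: lebesgue_tuple_setT.
have mQ : measurable cube by exact: measurable_unit_cube.
have muQ : lebesgue_tuple R (n * n) cube = 1%E by exact: lebesgue_tuple_unit_cube.
have muE (A B : set coords) : measurable A -> measurable B -> mu (A `*` B) =
    (lebesgue_tuple R (n * n) A * lebesgue_tuple R (n * n) B)%E.
  exact: product_measure1E.
have [] := @positive_quadratic_cases (Re a1) (Re a2) (Re g).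
- move=> y y0; have [] := Hpos (ln y); rewrite expRN lnK//.
  have HE s : y * Re (a1 * y%:C + a2 * (y^-1)%:C + s%:C * (2 * g)) =
      Re a1 * y ^+ 2 + Re a2 + s * (2 * Re g * y).
    case: (a1) (a2) (g) => [x1 y1] [x2 y2] [x3 y3] /=; field; exact: lt0r_neq0.
  rewrite -(pmulr_rgt0 _ y0) => h1; rewrite -(pmulr_rgt0 _ y0) => h2.
  split; first by have := HE 1; rewrite !mul1r => <-.
  by have := HE (-1); rewrite rmorphN rmorph1 !mulN1r => <-.
- by move=> [a0 b0 cab]; exact: herm_pair_coercive.
- move=> [a0 c0 b0].
  case: (@weight_not_cintegrable a1 a2 g (setT `*` cube)
    (\sum_(i < n) \sum_(j < n) Re a2) _ _ _ iw) => [|| x [_ Qx]].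
  + exact: measurableX.
  + by rewrite muE// muT muQ mule1.
  + rewrite Re_herm_action; apply: le_trans (herm_block_sum_le Qx (ltW b0)).
    rewrite /herm_term a0 c0; apply: ler_sum => i _; apply: ler_sum => j _.
    by rewrite !mul0r add0r addr0.
- move=> [b0 c0 a0].
  case: (@weight_not_cintegrable a1 a2 g (cube `*` setT)
    (\sum_(i < n) \sum_(j < n) Re a1) _ _ _ iw) => [|| x [Qx _]].
  + exact: measurableX.
  + by rewrite muE// muT muQ mul1e.
  + rewrite Re_herm_action; apply: le_trans (herm_block_sum_le Qx (ltW a0)).
    rewrite /herm_term b0 c0; apply: ler_sum => i _; apply: ler_sum => j _.
    by rewrite !mul0r !addr0.
Qed.

End DomainH.

(** * Uniqueness of the polynomial extension *)

Section Uniqueness.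
Variable R : realType.
Local Notation C := R[i].
Local Notation Re := (@complex.Re R).

Lemma horner_meval k (P : mpoly.mpoly k C) (vp : 'I_k -> {poly C}) :
  exists p : {poly C}, forall t, p.[t] = mpoly.meval (fun i => (vp i).[t]) P.
Proof.
exists (\sum_(m <- mpoly.msupp P) (mpoly.mcoeff m P)%:P * \prod_i vp i ^+ (m i)) => t.
rewrite mpoly.mevalE horner_sum; apply: eq_bigr => m _.
rewrite hornerM hornerC horner_prod; congr (_ * _).
by apply: eq_bigr => i _; rewrite horner_exp.
Qed.

Lemma poly_eq0_of_interval (p : {poly C}) (a : R) :
  (forall t : R, a <= t <= a + 1 -> p.[t%:C] = 0) -> p = 0.
Proof.
move=> Hp; apply/eqP/negPn/negP => p0.
pose f k : C := (a + k.+1%:R^-1)%:C.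
have f_inj : injective f.
  move=> k l [] /addrI /invr_inj /eqP; rewrite eqr_nat eqSS.
  by move/eqP.
have := @max_poly_roots _ p [seq f k | k <- iota 0 (size p)] p0.
rewrite size_map size_iota ltnn (map_inj_uniq f_inj) iota_uniq => h.
suff : false by [].
apply: h => //; apply/allP => _ /mapP[k _ ->]; apply/rootP/Hp.
by rewrite lerDl invr_ge0 ler0n lerD2l/= invf_le1// ler1n.
Qed.

(** One variable at a time is released from its interval to all of [C], by restricting [P] to a line
    and counting roots there. *)
Lemma meval3_eq0 (P : mpoly.mpoly 3 C) (a b c : R) :
  (forall x y z : R, a <= x <= a + 1 -> b <= y <= b + 1 -> c <= z <= c + 1 ->
    mpoly.meval (tnth [tuple x%:C; y%:C; z%:C]) P = 0) ->
  forall x y z : C, mpoly.meval (tnth [tuple x; y; z]) P = 0.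
Proof.
move=> HP.
have line (vp : 3.-tuple {poly C}) : exists p : {poly C}, forall t,
    p.[t] = mpoly.meval (tnth [tuple (tnth vp ord0).[t]; (tnth vp (inord 1)).[t];
                                     (tnth vp (inord 2)).[t]]) P.
  have [p Hp] := horner_meval P (tnth vp); exists p => t; rewrite Hp.
  congr (mpoly.meval _ P); apply/funext => i; rewrite [RHS](tnth_nth 0).
  case: i => [[|[|[|//]]] h] /=; congr (_.[t]); congr (tnth vp _); apply: val_inj;
    by rewrite //= inordK.
have H1 (x : C) (y z : R) : b <= y <= b + 1 -> c <= z <= c + 1 ->
    mpoly.meval (tnth [tuple x; y%:C; z%:C]) P = 0.
  move=> hy hz; have [p Hp] := line [tuple 'X; y%:C%:P; z%:C%:P].
  have {}Hp t : p.[t] = mpoly.meval (tnth [tuple t; y%:C; z%:C]) P.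
    by rewrite Hp !(tnth_nth 0) !inordK//= hornerX !hornerC.
  rewrite -Hp (@poly_eq0_of_interval p a) ?horner0// => t ht.
  by rewrite Hp HP.
have H2 (x y : C) (z : R) : c <= z <= c + 1 ->
    mpoly.meval (tnth [tuple x; y; z%:C]) P = 0.
  move=> hz; have [p Hp] := line [tuple x%:P; 'X; z%:C%:P].
  have {}Hp t : p.[t] = mpoly.meval (tnth [tuple x; t; z%:C]) P.
    by rewrite Hp !(tnth_nth 0) !inordK//= hornerX !hornerC.
  rewrite -Hp (@poly_eq0_of_interval p b) ?horner0// => t ht.
  by rewrite Hp H1.
move=> x y z; have [p Hp] := line [tuple x%:P; y%:P; 'X].
have {}Hp t : p.[t] = mpoly.meval (tnth [tuple x; y; t]) P.
  by rewrite Hp !(tnth_nth 0) !inordK//= hornerX !hornerC.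
rewrite -Hp (@poly_eq0_of_interval p c) ?horner0// => t ht.
by rewrite Hp H2.
Qed.

(** The box lives in the space of ratios. Sending [(x, y, z)] to its quotient by [x * y - z ^ 2] is
    an involution, so the parameters in the hypothesis are those whose ratios are exactly
    [(x, y, z)]. *)
Lemma extensionE (dom : C -> C -> C -> Prop) (E : C -> C -> C -> C)
    (P : mpoly.mpoly 3 C) (a b c : R) :
  (forall x y z : R, a <= x <= a + 1 -> b <= y <= b + 1 -> c <= z <= c + 1 ->
    x * y - z ^+ 2 != 0 /\
    dom (x / (x * y - z ^+ 2))%:C (y / (x * y - z ^+ 2))%:C (z / (x * y - z ^+ 2))%:C) ->
  polynomial_on dom E P ->
  forall a1 a2 g, extension dom E a1 a2 g = eval_ratios P a1 a2 g.
Proof.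
move=> Hdom HP a1 a2 g; rewrite /extension.
set Q := xget _ _.
have HQ : polynomial_on dom E Q.
  by rewrite /Q; case: xgetP => // H; case: (H P).
suff H x y z : mpoly.meval (tnth [tuple x; y; z]) (Q - P) = 0.
  by apply/eqP; rewrite -subr_eq0 /eval_ratios -mpoly.mevalB; apply/eqP; exact: H.
apply: (@meval3_eq0 _ a b c) => {}x {}y {}z hx hy hz.
have [d0 hd] := Hdom x y z hx hy hz.
have := HQ _ _ _ hd; rewrite (HP _ _ _ hd) /eval_ratios.
set d := x * y - z ^+ 2 in d0 *.
(* [delta] is homogeneous of degree 2, so dividing the three arguments by [d] divides its value [d]
   by [d ^ 2]. *)
have dE : delta (x / d)%:C (y / d)%:C (z / d)%:C = (d^-1)%:C.
  rewrite /delta -rmorphM -rmorphXn -rmorphB; congr (_%:C).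
  transitivity (d / d ^+ 2); first by rewrite /d; field.
  by field.
have rE (t : R) : (t / d)%:C / (d^-1)%:C = t%:C.
  by rewrite -fmorph_div/= invrK divfK.
by rewrite dE !rE mpoly.mevalB => ->; rewrite subrr.
Qed.

(** For [z] at most -2 and [x], [y] in [[0, 1]], both [x * y - z ^ 2] and [(x + y) * cos t + 2 * z]
    are negative, so their quotient is positive. *)
Lemma domain_C_box (x y z : R) :
  0 <= x <= 0 + 1 -> 0 <= y <= 0 + 1 -> -3 <= z <= -3 + 1 ->
  x * y - z ^+ 2 != 0 /\
  domain_C (x / (x * y - z ^+ 2))%:C (y / (x * y - z ^+ 2))%:C (z / (x * y - z ^+ 2))%:C.
Proof.
move=> /andP[x0 x1] /andP[y0 y1] /andP[z0 z1].
set d := x * y - z ^+ 2; have d0 : d < 0 by rewrite /d; nra.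
split; first by rewrite lt_eqF.
move=> t.
have -> : Re ((x / d)%:C * cexp (0 +i* t) + (y / d)%:C * cexp (0 -i* t) + 2 * (z / d)%:C) =
    ((x + y) * cos t + 2 * z) / d.
  by rewrite !ReD !ReM /cexp /= !expR0 cosN sinN; field; rewrite lt_eqF.
rewrite ltr_ndivlMr// mul0r.
have := cos_le1 t; have := cos_geN1 t; move: (cos t) => u; nra.
Qed.

Lemma domain_H_box n (x y z : R) :
  2 <= x <= 2 + 1 -> 2 <= y <= 2 + 1 -> 0 <= z <= 0 + 1 ->
  x * y - z ^+ 2 != 0 /\
  domain_H n (x / (x * y - z ^+ 2))%:C (y / (x * y - z ^+ 2))%:C (z / (x * y - z ^+ 2))%:C.
Proof.
move=> /andP[x0 x1] /andP[y0 y1] /andP[z0 z1].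
set d := x * y - z ^+ 2; have d0 : 0 < d by rewrite /d; nra.
have zxy : z ^+ 2 < x * y by rewrite -subr_gt0.
have xgt0 : 0 < x by lra.
have ygt0 : 0 < y by lra.
split; first by rewrite gt_eqF.
split.
  move=> t; have e0 := expR_gt0 t; rewrite expRN.
  have ex0 : 0 < expR t * d * x by rewrite !mulr_gt0.
  (* Completing the square; [s] is 1 or -1 and treats both signs of the coupling at once. *)
  have HE s : expR t * d * x * Re ((x / d)%:C * (expR t)%:C + (y / d)%:C * ((expR t)^-1)%:C +
      s%:C * (2 * (z / d)%:C)) = (x * expR t + s * z) ^+ 2 + (x * y - s ^+ 2 * z ^+ 2).
    by rewrite /=; field; rewrite !gt_eqF.
  split; rewrite -(pmulr_rgt0 _ ex0).
    have := HE 1; rewrite !mul1r => ->.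
    by rewrite ltr_wpDl ?sqr_ge0// expr1n mul1r subr_gt0.
  have := HE (-1); rewrite rmorphN rmorph1 !mulN1r => ->.
  by rewrite ltr_wpDl ?sqr_ge0// sqrrN expr1n mul1r subr_gt0.
apply: cdecays_cintegrable; apply: (cdecays_weight (@herm_pair_linear R n)).
apply: herm_pair_coercive; rewrite /= ?divr_gt0//.
rewrite expr_div_n mulrACA -invfM -expr2 ltr_pM2r// invr_gt0 exprn_gt0//.
Qed.

End Uniqueness.

Unset Implicit Arguments.

Theorem theorem3p3 (R : realType) (n : nat) (hn : (0 < n)%N)
    (F : 'M[R[i]]_n -> 'M[R[i]]_n -> R[i]) (hF : polynomial_invariant F) :
  [/\ (forall a1 a2 g : R[i], domain_H n a1 a2 g ->
         expectation_defined (@herm_pair R n) F a1 a2 g),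
      (exists P, polynomial_on (@domain_H R n) (gauss_expectation (@herm_pair R n) F) P),
      (forall a1 a2 g : R[i], domain_C a1 a2 g ->
         expectation_defined (@complex_pair R n) F a1 a2 g),
      (exists P, polynomial_on (@domain_C R) (gauss_expectation (@complex_pair R n) F) P)
    & forall a1 a2 g : R[i], delta a1 a2 g != 0 ->
        expectation_H F a1 a2 g = expectation_C F a1 a2 g].
Proof.
have [s Hs] := entry_polynomial_invariant hF.
have HH a1 a2 g (d : domain_H n a1 a2 g) := expectation_entry_sum
  (@herm_pair_linear R n) (@herm_pair_span R n) (herm_pair_split n a1 a2 g)
  (domain_H_coercive hn d) (Ordinal hn) Hs.
have HC a1 a2 g (d : domain_C a1 a2 g) := expectation_entry_sum
  (@complex_pair_linear R n) (@complex_pair_span R n) (complex_pair_split n a1 a2 g)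
  (domain_C_coercive n d) (Ordinal hn) Hs.
have PH : polynomial_on (@domain_H R n) (gauss_expectation (@herm_pair R n) F)
    (entry_sum_moment s) by move=> a1 a2 g /HH[].
have PC : polynomial_on (@domain_C R) (gauss_expectation (@complex_pair R n) F)
    (entry_sum_moment s) by move=> a1 a2 g /HC[].
split.
- by move=> a1 a2 g /HH[].
- by exists (entry_sum_moment s).
- by move=> a1 a2 g /HC[].
- by exists (entry_sum_moment s).
move=> a1 a2 g _; rewrite /expectation_H /expectation_C.
by rewrite (extensionE (@domain_H_box R n) PH) (extensionE (@domain_C_box R) PC).
Qed.
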